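(* Under the standing assumptions listed in the context, for any $(x_0,u_0)\in\mathcal H\times\mathcal H$ there exists a unique strong global solution $x:[t_0,+\infty)\to\mathcal H$ of the Cauchy problem $$\begin{cases}\ddot x(t)+\alpha(t)\dot x(t)+\beta(t)\dfrac{d}{dt}T_{\lambda(t),\gamma(t)}(x(t))+b(t)T_{\lambda(t),\gamma(t)}(x(t))=0\quad\text{for almost every }t\ge t_0,\\ x(t_0)=x_0,\quad \dot x(t_0)=u_0.\end{cases}$$
   Context: $\mathcal H$ is a real Hilbert space with inner product $\langle\cdot,\cdot\rangle$ and norm $\|\cdot\|$; $t_0\in\mathbb R$ is a fixed initial time. A set-valued operator $A:\mathcal H\to2^{\mathcal H}$ is $\rho$-comonotone ($\rho\in\mathbb R$) if $\langle x-y,u-v\rangle\ge\rho\|u-v\|^2$ for all $(x,u),(y,v)$ in its graph; it is maximal $\rho$-comonotone if moreover no $\rho$-comonotone operator has a graph properly containing that of $A$. A map $B:\mathcal H\to\mathcal H$ is $\nu$-cocoercive if $\langle Bx-By,x-y\rangle\ge\nu\|Bx-By\|^2$ for all $x,y$. $\operatorname{zer}(A+B)=\{x:0\in(A+B)(x)\}$. Resolvent: $J_{\gamma A}=(\operatorname{Id}+\gamma A)^{-1}$. Splitting operator: $T_{\lambda,\gamma}=\frac1\lambda\big(\operatorname{Id}-J_{\gamma A}\circ(\operatorname{Id}-\gamma B)\big)$. Standing assumptions: - $A$ is maximal $\rho$-comonotone, $B$ is $\nu$-cocoercive with $\nu>0$; $\lambda,\gamma,\delta,\theta,\phi,\psi:[t_0,+\infty)\to\mathbb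 R$ are continuously differentiable with $\lambda(t)>0$, $\delta(t)>0$, $\theta(t)\in[0,1]$, $\phi(t)\ge0$, $\psi(t)\ge0$, $\gamma(t)\in[\underline\gamma,\bar\gamma]\subset(\max\{0,-2\rho\},2\nu)$ for all $t\ge t_0$; and $\inf_{t\ge t_0}\Lambda(t)>0$, where $\Lambda(t)=\lambda(t)\frac{4\nu(\rho+\gamma(t))-\gamma^2(t)}{4\gamma(t)(\nu+\rho)}$. - $\operatorname{zer}(A+B)\ne\emptyset$. - With $\Gamma(t)=\theta(t)\phi(t)+(1-\theta(t))\psi(t)<1$, the coefficients are $$\alpha=\frac{\delta-\dot\Gamma}{1-\Gamma}-\frac{\dot\delta}{\delta},\qquad \beta=\frac{\lambda\theta}{1-\Gamma},\qquad b=\frac{\frac{d}{dt}(\lambda\theta)-\lambda\theta\,\frac{\dot\delta}{\delta}}{1-\Gamma},$$ and they satisfy $\alpha(t)>0$, $b(t)\ge0$, $\beta(t)>0$ for all $t\ge t_0$; $\alpha,b$ are locally integrable and $\beta$ is locally absolutely continuous. A strong global solution with Cauchy data $(x_0,u_0)$ is a function $x:[t_0,+\infty)\to\mathcal H$ such that $x,\dot x$ are continuous and absolutely continuous on each bounded interval $[t_0,T]$, the equation holds for almost every $t\ge t_0$, and $x(t_0)=x_0$, $\dot x(t_0)=u_0$. Here $\frac{d}{dt}T_{\lambda(t),\gamma(t)}(x(t))$ is the derivative of $t\mapsto T_{\lambda(t),\gamma(t)}(x(t))$. *)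

(* Defs.v *)
From HB Require Import structures.
From mathcomp Require Import all_boot all_order all_algebra.
From mathcomp Require Import all_classical all_reals all_analysis.

Set Implicit Arguments.
Unset Strict Implicit.
Unset Printing Implicit Defensive.

Import Order.TTheory GRing.Theory Num.Theory.
Import numFieldNormedType.Exports.

Local Open Scope classical_set_scope.
Local Open Scope ring_scope.

(* A real Hilbert space is a complete normed module H over R together with
   dot : {dot H for idfun} (bilinear, symmetric, positive definite) inducing
   the norm of H. *)
Definition induces_norm (R : realType) (H : completeNormedModType R)
    (dot : {dot H for (idfun : R -> R)}) :=
  forall x : H, dot x x = `|x| ^+ 2.

Section Operators.
Context {R : realType} {H : completeNormedModType R}.
Variable dot : {dot H for (idfun : R -> R)}.
Implicit Types (A : H -> set H) (B : H -> H).

Definition comonotone (rho : R) A :=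
  forall x y u v, A x u -> A y v ->
    rho * `|u - v| ^+ 2 <= dot (x - y) (u - v).

Definition maximal_comonotone (rho : R) A :=
  comonotone rho A /\
  forall A', comonotone rho A' ->
    (forall x, A x `<=` A' x) -> forall x, A' x `<=` A x.

Definition cocoercive (nu : R) B :=
  forall x y, nu * `|B x - B y| ^+ 2 <= dot (B x - B y) (x - y).

Definition op_add A B : H -> set H := fun x => [set u + B x | u in A x].

Definition zer A : set H := [set x | A x 0].

Definition op_inv A : H -> set H := fun y => [set x | A x y].

Definition id_plus (gamma : R) A : H -> set H :=
  fun x => [set x + gamma *: u | u in A x].

(* (Id + gamma A)^-1 as a set-valued operator *)
Definition set_resolvent (gamma : R) A : H -> set H :=
  op_inv (id_plus gamma A).

(* J_{gamma A} as a map: the element of [set_resolvent gamma A y], which is a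
   singleton when A is maximal rho-comonotone and gamma > max(0, -2 rho);
   the value 0 is only taken where the set-valued resolvent is empty. *)
Definition resolvent (gamma : R) A : H -> H :=
  fun y => xget 0 (set_resolvent gamma A y).

Definition splitting A B (lambda gamma : R) : H -> H :=
  fun x => lambda^-1 *: (x - resolvent gamma A (x - gamma *: B x)).

End Operators.

(* Calculus on [t0, +oo[ for functions given on the whole of R: difference
   quotients are restricted to [t0, +oo[, so that the derivative is the usual
   one on ]t0, +oo[ and the right derivative at t0, and values taken before t0
   are irrelevant. *)
Section HalfLine.
Context {R : realType} {V : normedModType R}.
Implicit Types f : R -> V.

Definition derivable_from (t0 : R) f (t : R) :=
  cvg ((fun s => (s - t)^-1 *: (f s - f t)) @ within `[t0, +oo[ t^').

Definition derive_from (t0 : R) f (t : R) : V :=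
  lim ((fun s => (s - t)^-1 *: (f s - f t)) @ within `[t0, +oo[ t^').

Definition C1_from (t0 : R) f :=
  (forall t, t0 <= t -> derivable_from t0 f t) /\
  {within `[t0, +oo[, continuous (derive_from t0 f)}.

Definition absolutely_continuous (a b : R) f :=
  forall e : R, 0 < e -> exists2 d : R, 0 < d &
    forall (n : nat) (u v : 'I_n -> R),
      (forall i, [/\ a <= u i, u i <= v i & v i <= b]) ->
      trivIset [set: 'I_n] (fun i => `]u i, v i[%classic) ->
      \sum_(i < n) (v i - u i) < d ->
      \sum_(i < n) `|f (v i) - f (u i)| < e.

Definition loc_absolutely_continuous (t0 : R) f :=
  forall T, t0 <= T -> absolutely_continuous t0 T f.

End HalfLine.

Definition loc_integrable_from (R : realType) (t0 : R) (f : R -> R) :=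
  forall T, t0 <= T ->
    (@lebesgue_measure R).-integrable `[t0, T] (EFin \o f).

Section Coefficients.
Context {R : realType}.
Variables (t0 : R) (lambda gamma delta theta phi psi : R -> R).

Definition Lambda (rho nu : R) (t : R) : R :=
  lambda t * ((4 * nu * (rho + gamma t) - gamma t ^+ 2)
              / (4 * gamma t * (nu + rho))).

Definition Gamma (t : R) : R :=
  theta t * phi t + (1 - theta t) * psi t.

Definition alpha (t : R) : R :=
  (delta t - derive_from t0 Gamma t) / (1 - Gamma t)
  - derive_from t0 delta t / delta t.

Definition beta (t : R) : R := lambda t * theta t / (1 - Gamma t).

Definition bcoef (t : R) : R :=
  (derive_from t0 (fun s => lambda s * theta s) t
   - lambda t * theta t * (derive_from t0 delta t / delta t))
  / (1 - Gamma t).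

End Coefficients.

(* Strong global solution on [t0, +oo[ of
     x'' + a x' + c d/dt (T t (x t)) + b T t (x t) = 0,
   x(t0) = x0, x'(t0) = u0, for a time-dependent operator T. *)
Definition strong_global_solution (R : realType) (H : completeNormedModType R)
    (t0 : R) (a c b : R -> R) (T : R -> H -> H) (x0 u0 : H) (x : R -> H) :=
  let x' := derive_from t0 x in
  let Tx := fun t => T t (x t) in
  [/\ forall t, t0 <= t -> derivable_from t0 x t,
      {within `[t0, +oo[, continuous x} /\
      {within `[t0, +oo[, continuous x'},
      loc_absolutely_continuous t0 x /\ loc_absolutely_continuous t0 x',
      {ae (@lebesgue_measure R), forall t : R, t0 <= t ->
        [/\ derivable_from t0 x' t,
            derivable_from t0 Tx t &
            derive_from t0 x' t + a t *: x' t
            + c t *: derive_from t0 Tx t + b t *: Tx t = 0]} &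
      x t0 = x0 /\ x' t0 = u0].

(* Main.v *)
Require Import Defs.
From HB Require Import structures.
From mathcomp Require Import all_boot all_order all_algebra.
From mathcomp Require Import all_classical all_reals all_analysis.
From mathcomp Require Import measurable_realfun ring lra.

(* The equation is reduced to a first-order Lipschitz system and then lifted
   back, the second step resting on a Rademacher theorem in Hilbert space.

   By Minty's theorem, obtained by minimizing a quadratic perturbation of the
   Fitzpatrick function, the resolvent of a maximal rho-comonotone operator is
   everywhere defined, and it is nonexpansive because gamma > max(0, - 2 rho).
   Hence T_{lambda(t), gamma(t)} is Lipschitz in x, locally uniformly in t, and
   sends locally Lipschitz curves to locally Lipschitz curves.  Setting
   y = x' + beta T(x) turns the equation into
     x' = y - beta T(x),  y' = - alpha (y - beta T(x)) + (beta' - b) T(x),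
   whose coefficients are continuous, so the Picard iteration converges.

   Conversely, along a solution of this system T(x(t)) is a locally Lipschitz
   curve, and such curves are differentiable almost everywhere: the moduli of
   the derivatives of its distances to a dense sequence of its values have as
   supremum the metric derivative m(t), and by uniform convexity the difference
   quotients then cluster.  Uniqueness is a Gronwall argument for absolutely
   continuous functions satisfying the system almost everywhere. *)

Set Implicit Arguments.
Unset Strict Implicit.
Unset Printing Implicit Defensive.

Import Order.TTheory GRing.Theory Num.Theory.
Import numFieldNormedType.Exports.

Local Open Scope classical_set_scope.
Local Open Scope ring_scope.

(** * Minty's theorem and resolvents *)

(** The obstacle is the term [d/dt T(x(t))]: [T] is only Lipschitz, so this derivative exists at
    best almost everywhere and cannot be part of a vector field. Up to [beta' T(x)] it belongs to
    the derivative of the product [beta T(x)], so the substitution absorbs it and leaves [beta' - b]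
    as a coefficient. The price is paid twice: existence has to recover the differentiability of
    [T(x(t))] afterwards, and uniqueness has to compare curves that satisfy the system only almost
    everywhere. Locally Lipschitz curves are the class that fits, being stable under resolvents with
    moving parameter, which C1 curves are not. No vector-valued integral occurs: primitives and mean
    value inequalities for curves in [H] come from interval induction ([cousin]), and Lebesgue
    integrals are taken of real functions only, namely the densities of distance functions. *)

Section Hilbert.
Context {R : realType} {H : completeNormedModType R}.
Context {dot : {dot H for (idfun : R -> R)}}.
Implicit Types (x y z u v : H) (k : R).

Lemma dotC x y : dot x y = dot y x.
Proof. by rewrite hermC/= expr0 mul1r. Qed.

Lemma dotDl x y z : dot (x + y) z = dot x z + dot y z.
Proof. exact: linearDl. Qed.

Lemma dotDr x y z : dot x (y + z) = dot x y + dot x z.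
Proof. exact: linearDr. Qed.

Lemma dotNl x y : dot (- x) y = - dot x y.
Proof. exact: linearNl. Qed.

Lemma dotNr x y : dot x (- y) = - dot x y.
Proof. exact: linearNr. Qed.

Lemma dotZl k x y : dot (k *: x) y = k * dot x y.
Proof. exact: linearZl_LR. Qed.

Lemma dotZr k x y : dot x (k *: y) = k * dot x y.
Proof. exact: linearZr_LR. Qed.

Definition dotE := (dotDl, dotDr, dotNl, dotNr, dotZl, dotZr).

Hypothesis hdot : induces_norm dot.

Lemma normsqE x : `|x| ^+ 2 = dot x x. Proof. by rewrite hdot. Qed.

Lemma normsqD x y : `|x + y| ^+ 2 = `|x| ^+ 2 + 2 * dot x y + `|y| ^+ 2.
Proof. by rewrite !normsqE !dotE (dotC y x); ring. Qed.

Lemma normsqB x y : `|x - y| ^+ 2 = `|x| ^+ 2 - 2 * dot x y + `|y| ^+ 2.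
Proof. by rewrite normsqD dotNr normrN; ring. Qed.

(** With [p = |x| |y|], the square of [|y| x - |x| y] expands to [2 p (p - dot x y)]; dividing by
    [p > 0] concludes. *)
Lemma CauchySchwarz x y : dot x y <= `|x| * `|y|.
Proof.
have [->|x0] := eqVneq x 0; first by rewrite -[X in dot X _](scale0r 0) dotZl normr0 !mul0r.
have [->|y0] := eqVneq y 0.
  by rewrite -[X in dot _ X](scale0r 0) dotZr normr0 mulr0 mul0r.
have := sqr_ge0 `| `|y| *: x - `|x| *: y|.
rewrite normsqB !normrZ !normr_id dotZl dotZr.
have : 0 < `|x| * `|y| by rewrite mulr_gt0// normr_gt0.
set p := _ * _; have -> : (`|y| * `|x|) = p by rewrite mulrC.
have -> : `|y| * (`|x| * dot x y) = p * dot x y by rewrite /p; ring.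
move=> p0 h; rewrite -(ler_pM2l p0).
by rewrite -/p in h *; nra.
Qed.

End Hilbert.

Section Minty.
Context {R : realType} {H : completeNormedModType R}.
Context {dot : {dot H for (idfun : R -> R)}} (hdot : induces_norm dot).
Variable G : H -> H -> Prop.
Hypothesis Gmono : forall a b a' b', G a b -> G a' b' ->
  0 <= dot (a - a') (b - b').
Hypothesis Gmax : forall x u,
  (forall a b, G a b -> 0 <= dot (x - a) (u - b)) -> G x u.

(* The epigraph of the Fitzpatrick function of [G]. *)
Let K (x u : H) (s : R) := forall a b, G a b -> dot x b + dot a u - dot a b <= s.

Let K_graph a b : G a b -> K a b (dot a b).
Proof.
move=> Gab c d Gcd; have := Gmono Gab Gcd.
by rewrite !dotE; lra.
Qed.

(** If it failed, every [dot (x - a) (u - b)] would be at least [dot x u - s > 0], so maximality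
    would put [(x, u)] in the graph; but the constraint of [K] taken at [(x, u)] itself reads
    [dot x u <= s]. *)
Let K_dot x u s : K x u s -> dot x u <= s.
Proof.
move=> Kxus; rewrite leNgt; apply/negP => s_lt.
suff /Kxus : G x u by lra.
apply: Gmax => a b /Kxus; rewrite !dotE; lra.
Qed.

Let K_convex (e : R) x u s y v t : 0 <= e <= 1 -> K x u s -> K y v t ->
  K ((1 - e) *: x + e *: y) ((1 - e) *: u + e *: v) ((1 - e) * s + e * t).
Proof.
move=> e01 Kx Ky a b Gab; have := Kx _ _ Gab; have := Ky _ _ Gab.
rewrite !dotE; nra.
Qed.

(** Since [s >= dot x u] on [K], there [Q] dominates [|x + u|^2 / 4], the squared defect from
    [u = - x]. It is strictly convex in the direction [x - u] only, hence convergence can be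
    expected for these differences alone. *)
Let Q (x u : H) (s : R) : R := s + `|x - u| ^+ 2 / 4.

Let K_Q x u s : K x u s -> 0 <= Q x u s.
Proof.
move=> /K_dot; rewrite /Q (normsqB hdot) => ?.
have := sqr_ge0 `|x + u|; rewrite (normsqD hdot); lra.
Qed.

(* Minimizing [Q] over the convex set [K] replaces the Hahn-Banach argument of
   the textbook proofs: a minimizing sequence has Cauchy differences [x - u],
   and half their limit is the required point. *)
Lemma minty : exists z, G z (- z).
Proof.
pose S := [set r | exists x u s, K x u s /\ r = Q x u s].
have [[a0 [b0 Gab0]]|] := pselect (exists a b, G a b); last first.
  move=> nG; exists 0; apply: Gmax => a b Gab; exfalso; apply: nG.
  by exists a, b.
have S_lb : has_lbound S by exists 0 => _ [x [u [s [/K_Q ? ->]]]].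
have hS : has_inf S.
  split => //; move: Gab0 => Gb; exists (Q a0 b0 (dot a0 b0)).
  by exists a0, b0, (dot a0 b0); split => //; exact: K_graph.
pose q := inf S.
have q_ge0 : 0 <= q.
  by apply: lb_le_inf; [case: hS|move=> _ [x [u [s [/K_Q ? ->]]]]].
have q_le x u s : K x u s -> q <= Q x u s.
  by move=> Kx; apply: ge_inf => //; exists x, u, s.
pose e n : R := n.+1%:R^-1.
have e_gt0 n : 0 < e n by rewrite invr_gt0.
have e_le1 n : e n <= 1 by rewrite invf_le1// ler1n.
(* The tolerance is the square of the step [e n] because the inequality obtained in [key] is divided
   by [e n]. *)
have /choice [w wP] : forall n, exists w : H * H * R,
    K w.1.1 w.1.2 w.2 /\ Q w.1.1 w.1.2 w.2 <= q + (e n) ^+ 2.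
  move=> n; have [_ [x [u [s [Kx ->]]]] Qlt] := inf_adherent (exprn_gt0 2 (e_gt0 n)) hS.
  by exists (x, u, s); split => //; exact: ltW.
pose p n := (w n).1.1 - (w n).1.2.
(* The midpoint of two near-minimizers is admissible; the parallelogram identity turns its value
   being at least [q] into this bound. *)
have p_dist m n : `|p m - p n| ^+ 2 <= 8 * ((e m) ^+ 2 + (e n) ^+ 2).
  have [Km Qm] := wP m; have [Kn Qn] := wP n.
  have half01 : 0 <= (2^-1 : R) <= 1 by lra.
  have := q_le _ _ _ (K_convex half01 Km Kn).
  move: Qm Qn; rewrite /Q /p.
  rewrite opprD addrACA -!scalerBr.
  set P := (w m).1.1 - _; set P' := (w n).1.1 - _.
  clearbody P P'.
  have -> : (1 - 2^-1 : R) = 2^-1 by lra.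
  rewrite -(scalerDr _ P P') normrZ exprMn real_normK ?num_real//.
  rewrite (normsqB hdot P P') (normsqD hdot P P').
  lra.
have e_cvg : e @ \oo --> 0 by exact: cvg_harmonic.
have p_cvg : cvg (p @ \oo).
  apply/cauchy_cvgP/cauchy_exP => _/posnumP[d].
  have : \forall n \near \oo, e n < d%:num / 4.
    by apply: (cvgr_lt _ e_cvg); rewrite divr_gt0.
  case=> N _ HN; exists (p N); exists N => // n /= Nn.
  rewrite -ball_normE/= -ltr_sqr ?nnegrE// (le_lt_trans (p_dist _ _))//.
  have := HN _ (leqnn N); have := HN _ Nn => /=.
  have := e_gt0 N; have := e_gt0 n; have : 0 < d%:num by [].
  by move: (e n) (e N) d%:num => a b c; nra.
set pl := lim (p @ \oo) in p_cvg.
(* First-order optimality: [w n] is moved towards the graph point [(a, b, dot a b)] with weight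
   [e n], the result is compared with [q], divided by [e n], and [n] tends to infinity. *)
have key a b : G a b -> `|(a - b) - pl| ^+ 2 / 4 <= - q + dot a b + `|a - b| ^+ 2 / 4.
  move=> Gab; set p0 := a - b.
  have bound n : (1 - e n) * `|p0 - p n| ^+ 2 / 4 <=
      e n + (- q + dot a b + `|p0| ^+ 2 / 4).
    have [Kn Qn] := wP n.
    have e01 : 0 <= e n <= 1 by rewrite e_le1 ltW.
    have := q_le _ _ _ (K_convex e01 Kn (K_graph Gab)).
    move: Qn; rewrite /Q -/(p n) opprD addrACA -!scalerBr -/(p n) -/p0.
    move: (p n) => pn; clearbody p0.
    rewrite (normsqD hdot (_ *: _)) (normsqB hdot p0 pn) dotZl dotZr.
    rewrite !normrZ !exprMn !real_normK ?num_real// (dotC p0 pn).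
    have := e_gt0 n; have := e_le1 n.
    move: (e n) (w n).2 (`|pn| ^+ 2) (`|p0| ^+ 2) (dot pn p0) => E s A B C.
    move=> E1 E0 h1 h2.
    rewrite -(ler_pM2l E0).
    have : (1 - E) * (s + A / 4) <= (1 - E) * (q + E ^+ 2) by rewrite ler_wpM2l//; lra.
    have : E ^+ 3 <= E ^+ 2 by rewrite exprS ler_piMl// sqr_ge0.
    nra.
  have L : (fun n => (1 - e n) * `|p0 - p n| ^+ 2 / 4) @ \oo -->
      (1 - 0) * `|p0 - pl| ^+ 2 / 4.
    apply: cvgM; last exact: cvg_cst.
    apply: cvgM; first by apply: cvgB => //; exact: cvg_cst.
    by apply: cvgM; apply: cvg_norm; apply: cvgB => //; exact: cvg_cst.
  have M : (fun n => e n + (- q + dot a b + `|p0| ^+ 2 / 4)) @ \oo -->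
      0 + (- q + dot a b + `|p0| ^+ 2 / 4).
    by apply: cvgD => //; exact: cvg_cst.
  have := ler_cvg_to L M _; rewrite subr0 mul1r add0r; apply.
  exact: nearW.
(* For [z = pl / 2], expanding [key] gives [dot (z - a) (- z - b) >= q], and [q] is nonnegative. *)
exists (2^-1 *: pl); apply: Gmax => a b /key.
rewrite (normsqB hdot) !(normsqE hdot) !dotE (dotC b a) (dotC b pl).
by rewrite (dotC pl a); have := q_ge0; lra.
Qed.

End Minty.

Section Resolvent.
Context {R : realType} {H : completeNormedModType R}.
Context {dot : {dot H for (idfun : R -> R)}} (hdot : induces_norm dot).
Context {A : H -> set H} {rho : R} (hA : maximal_comonotone dot rho A).

Lemma maximal_comonotone_mem x u :
  (forall y v, A y v -> rho * `|u - v| ^+ 2 <= dot (x - y) (u - v)) -> A x u.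
Proof.
move=> xu; have [Acom Amax] := hA.
apply: (Amax (fun y => A y `|` [set v | y = x /\ v = u])); first last.
- by right.
- by move=> y v; left.
move=> y z v w [Ayv|[-> ->]] [Azw|[-> ->]]; first exact: Acom.
- have := xu _ _ Ayv; rewrite -opprB normrN -(opprB y x).
  by rewrite dotNl dotNr opprK.
- exact: xu.
- by rewrite !subrr -[X in dot X _](scale0r 0) dotZl normr0 expr0n mulr0 mul0r.
Qed.

(** Comonotonicity of [A] is monotonicity of [A^-1 - rho Id]. Accordingly [G] relates
    [a = x - rho u - y] to [b = k u] for [(x, u)] in the graph of [A]; it is maximal monotone,
    [shift] translating between the two inequalities, and Minty's condition [b = - a] reads
    [x + g u = y] because [k - rho = g]. *)
Lemma resolvent_exists g : 0 < g + rho -> forall y, exists x, set_resolvent g A y x.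
Proof.
move=> g_gt0 y; set k := g + rho in g_gt0.
have k0 : k != 0 by rewrite gt_eqF.
pose G (a b : H) := A (a + y + (rho / k) *: b) (k^-1 *: b).
have shift a b a' b' (c : H) : dot (a - a') (b - b') = k *
    (dot ((a + c + (rho / k) *: b) - (a' + c + (rho / k) *: b'))
         (k^-1 *: b - k^-1 *: b') - rho * `|k^-1 *: b - k^-1 *: b'| ^+ 2).
  rewrite -scalerBr normrZ exprMn real_normK ?num_real// (normsqE hdot).
  have -> : a + c + (rho / k) *: b - (a' + c + (rho / k) *: b') =
      (a - a') + (rho / k) *: (b - b').
    by rewrite scalerBr opprD addrACA (opprD a') [in LHS](addrACA a) subrr addr0.
  rewrite dotZr (dotDl (a - a')) dotZl; move: (dot (b - b') _) (dot _ _) => E D.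
  by field.
have [z Gz] : exists z, G z (- z).
  apply: (minty hdot).
    move=> a b a' b' Gab Gab'; rewrite (shift _ _ _ _ y).
    by apply: mulr_ge0; [exact: ltW|rewrite subr_ge0; exact: hA.1].
  move=> x u xu; apply: maximal_comonotone_mem => a b Aab.
  have := xu (a - y - rho *: b) (k *: b).
  rewrite /G scalerA divfK// scalerA mulVf// scale1r [a - y - _ + _]addrAC.
  rewrite subrK subrK => /(_ Aab).
  rewrite (shift _ _ _ _ y) scalerA divfK// scalerA mulVf// scale1r.
  rewrite [a - y - _ + _]addrAC subrK subrK.
  by rewrite pmulr_rge0// subr_ge0.
exists (z + y + (rho / k) *: - z) => /=.
exists (k^-1 *: - z) => //.
rewrite scalerA -addrA -scalerDl -mulrDl (addrC rho) divff// scale1r.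
by rewrite addrAC subrr add0r.
Qed.

Variable g : R.
Hypotheses (g_gt0 : 0 < g) (g_rho : - 2 * rho < g).

Lemma resolventP y : exists2 u, A (resolvent g A y) u & resolvent g A y + g *: u = y.
Proof.
have [|x yx] := @resolvent_exists g _ y; first (move: g_gt0 g_rho; lra).
have /= [u Au E] := xgetI 0 yx.
by exists u.
Qed.

(** Expanding the square on the right, comonotonicity leaves the surplus [g (g + 2 rho) |u - v|^2],
    nonnegative exactly under the two bounds on [g]. *)
Lemma resolvent_nonexpansive x y u v : A x u -> A y v ->
  `|x - y| <= `|(x + g *: u) - (y + g *: v)|.
Proof.
move=> Axu Ayv; rewrite -ler_sqr ?nnegrE//.
have -> : x + g *: u - (y + g *: v) = (x - y) + g *: (u - v).
  by rewrite scalerBr opprD addrACA.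
rewrite (normsqD hdot (x - y)) dotZr normrZ exprMn real_normK ?num_real//.
have := hA.1 _ _ _ _ Axu Ayv.
have := sqr_ge0 `|u - v|; move: (`|u - v| ^+ 2) (dot _ _) => N D N0 ND.
have : 0 <= (g + 2 * rho) * N by rewrite mulr_ge0//; (move: g_gt0 g_rho; lra).
have := g_gt0; nra.
Qed.

End Resolvent.

Section Splitting.
Context {R : realType} {H : completeNormedModType R}.
Context {dot : {dot H for (idfun : R -> R)}} (hdot : induces_norm dot).

(** With [v = (y' - J') / g'] in [A J'], where [J'] is the second resolvent, [J'] is also the
    resolvent with parameter [g] of [y' + (g - g') v]. A change of parameter thus becomes a change
    of argument, and nonexpansiveness for the single parameter [g] applies. *)
Lemma resolvent_dist {A : H -> set H} {rho : R} (hA : maximal_comonotone dot rho A)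
    (g g' : R) (y y' : H) : 0 < g -> - 2 * rho < g -> 0 < g' -> - 2 * rho < g' ->
  `|resolvent g A y - resolvent g' A y'| <=
    `|y - y'| + `|g - g'| * (g'^-1 * `|y' - resolvent g' A y'|).
Proof.
move=> g0 gr g0' gr'.
have [u Au Eu] := resolventP hdot hA g0 gr y.
have [v Av Ev] := resolventP hdot hA g0' gr' y'.
apply: le_trans (resolvent_nonexpansive hdot hA g0 gr Au Av) _.
rewrite Eu.
have -> : y - (resolvent g' A y' + g *: v) = (y - y') - (g - g') *: v.
  by rewrite -[in RHS]Ev -addrA -opprD scalerBl -addrA [g' *: v + _]addrC subrK.
apply: le_trans (ler_normB _ _) _; rewrite normrZ lerD2l ler_wpM2l//.
have -> : y' - resolvent g' A y' = g' *: v by rewrite -[X in X - _]Ev addrC addKr.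
rewrite normrZ gtr0_norm// mulrA mulVf ?mul1r//.
by rewrite gt_eqF.
Qed.

Lemma cocoercive_lipschitz (B : H -> H) (nu : R) (x y : H) : 0 < nu ->
  cocoercive dot nu B -> `|B x - B y| <= nu^-1 * `|x - y|.
Proof.
move=> nu0 /(_ x y) => h; rewrite ler_pdivlMl//.
have := le_trans h (CauchySchwarz hdot _ _).
have [->|B0] := eqVneq (B x - B y) 0; first by rewrite normr0 mulr0.
by rewrite expr2 mulrCA ler_pM2l// normr_gt0.
Qed.

End Splitting.

(** * Differential calculus on a half-line *)

Section HalfLineCalculus.
Context {R : realType} {t0 : R}.

(* Unlike [derive_from], this relational form does not need the point to be an
   accumulation point of [t0, +oo[; both agree for [t0 <= t]. *)
Definition has_deriv (V : normedModType R) (f : R -> V) (t : R) (l : V) :=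
  forall e : R, 0 < e -> \forall s \near t, t0 <= s ->
    `|f s - f t - (s - t) *: l| <= e * `|s - t|.

Definition cont_from (V : normedModType R) (f : R -> V) (t : R) :=
  f s @[s --> within `[t0, +oo[ (nbhs t)] --> f t.

Section Vector.
Context {V : normedModType R}.
Implicit Types (f g : R -> V) (k : R -> R) (l : V).

Lemma cont_fromP f t : cont_from f t <->
  forall e : R, 0 < e -> \forall s \near t, t0 <= s -> `|f s - f t| <= e.
Proof.
split=> [/cvgrPdist_le h e /h|h].
  by rewrite !near_withinE; apply: filterS => s; rewrite /= in_itv/= andbT distrC.
apply/cvgrPdist_le => e /h; rewrite !near_withinE.
by apply: filterS => s; rewrite /= in_itv/= andbT distrC.
Qed.

Lemma has_derivP f t l : has_deriv f t l <->
  (fun s => (s - t)^-1 *: (f s - f t)) @ within `[t0, +oo[ t^' --> l.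
Proof.
split=> [h|/cvgrPdist_le h e /h].
  apply/cvgrPdist_le => e /h; rewrite near_withinE near_withinE.
  apply: filterS => s hs /= st; rewrite in_itv/= andbT => /hs.
  have st0 : s - t != 0 by rewrite subr_eq0.
  rewrite -[in leRHS](mulr1 e) => {}hs.
  rewrite distrC -(ler_pM2r (x := `|s - t|)) ?normr_gt0//.
  rewrite mulrC -normrZ scalerBr scalerA divff// scale1r.
  by rewrite mulr1 in hs.
rewrite near_withinE near_withinE; apply: filterS => s /= hs t0s.
have [->|st] := eqVneq s t; first by rewrite !subrr scale0r subr0 !normr0 mulr0.
have st0 : s - t != 0 by rewrite subr_eq0.
move: (hs st); rewrite in_itv/= andbT => /(_ t0s).
rewrite distrC -(ler_pM2r (x := `|s - t|)) ?normr_gt0//.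
by rewrite mulrC -normrZ scalerBr scalerA divff// scale1r.
Qed.

Lemma proper_within_from t : t0 <= t -> ProperFilter (within `[t0, +oo[ t^').
Proof.
move=> t0t; apply: Build_ProperFilter => Pt.
have /nbhs_ballP[e /= e0 h] : nbhs t [set x | x != t -> `[t0, +oo[%classic x -> set0 x].
  exact: Pt.
apply: (h (t + e / 2)) => /=.
- by rewrite /ball/= opprD addNKr normrN gtr0_norm ?divr_gt0// ltr_pdivrMr// ltr_pMr// ltr1n.
- by rewrite gt_eqF// ltrDl divr_gt0.
- by rewrite in_itv/= andbT (le_trans t0t)// lerDl divr_ge0// ltW.
Qed.

Lemma has_deriv_from f t l : t0 <= t -> has_deriv f t l ->
  derivable_from t0 f t /\ derive_from t0 f t = l.
Proof.
move=> /proper_within_from P /has_derivP h; split; first by apply/cvg_ex; exists l.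
exact/cvg_lim.
Qed.

Lemma derivable_from_has_deriv f t : derivable_from t0 f t ->
  has_deriv f t (derive_from t0 f t).
Proof. by move=> /cvg_ex[l hl]; apply/has_derivP; apply/cvg_ex; exists l. Qed.

Lemma has_deriv_cont f t l : has_deriv f t l -> cont_from f t.
Proof.
move=> h; apply/cont_fromP => e e0; have := h 1 ltr01.
have : \forall s \near t, `|s - t| <= e / (1 + `|l|).
  have d0 : 0 < e / (1 + `|l|) by rewrite divr_gt0// ltr_pwDl.
  by apply/nbhs_ballP; exists (e / (1 + `|l|)) => //= s; rewrite /ball/= distrC => /ltW.
apply: filterS2 => s h1 h2 t0s.
rewrite -(subrK ((s - t) *: l) (f s - f t)).
apply: le_trans (ler_normD _ _) _.
apply: le_trans (lerD (h2 t0s) (lexx _)) _.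
rewrite normrZ mul1r -[X in X + _]mulr1 -mulrDr.
by rewrite -ler_pdivlMr// ltr_pwDl.
Qed.

Lemma within_from_dnbhs f t (l : V) :
  f s @[s --> within `[t0, +oo[ (nbhs t)] --> l ->
  f s @[s --> within `[t0, +oo[ t^'] --> l.
Proof.
move=> /cvgrPdist_le h; apply/cvgrPdist_le => e /h.
by rewrite !near_withinE; apply: filterS => s h' _.
Qed.

Lemma has_derivD f g t l l' : has_deriv f t l -> has_deriv g t l' ->
  has_deriv (fun s => f s + g s) t (l + l').
Proof.
move=> /has_derivP hf /has_derivP hg; apply/has_derivP.
apply: (cvg_trans _ (cvgD hf hg)); apply: near_eq_cvg.
by apply: nearW => s /=; rewrite !fctE -scalerDr opprD addrACA.
Qed.

Lemma has_derivN f t l : has_deriv f t l -> has_deriv (fun s => - f s) t (- l).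
Proof.
move=> /has_derivP hf; apply/has_derivP.
apply: (cvg_trans _ (cvgN hf)); apply: near_eq_cvg.
by apply: nearW => s /=; rewrite !fctE -scalerN opprB opprK (addrC (f t)).
Qed.

Lemma has_derivB f g t l l' : has_deriv f t l -> has_deriv g t l' ->
  has_deriv (fun s => f s - g s) t (l - l').
Proof. by move=> hf hg; apply: has_derivD => //; exact: has_derivN. Qed.

Lemma has_deriv_cst (a : V) t : has_deriv (fun=> a) t 0.
Proof.
move=> e e0; near=> s => _.
by rewrite subrr scaler0 subrr normr0 mulr_ge0// ltW.
Unshelve. all: by end_near. Qed.

Lemma eq_has_deriv f g t l : t0 <= t -> (forall s, t0 <= s -> f s = g s) ->
  has_deriv f t l -> has_deriv g t l.
Proof.
move=> t0t fg h e /h; apply: filterS => s hs t0s.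
by rewrite -!fg//; exact: hs.
Qed.

End Vector.

Lemma has_derivZ (V : normedModType R) (k : R -> R) (f : R -> V) t (k' : R) l :
  has_deriv (V := R) k t k' -> has_deriv f t l ->
  has_deriv (fun s => k s *: f s) t (k t *: l + k' *: f t).
Proof.
move=> hk /has_derivP hf; have /within_from_dnbhs kc := has_deriv_cont hk.
move: hk => /has_derivP hk; apply/has_derivP.
apply: (cvg_trans _ (cvgD (cvgZ kc hf) (cvgZ hk (cvg_cst (f t))))).
apply: near_eq_cvg; apply: nearW => s /=.
rewrite !fctE; set c := (s - t)^-1.
rewrite scalerA (mulrC (k s)) -scalerA -[c *: (k s - k t)]/(c * _) -scalerA.
by rewrite -scalerDr scalerBr scalerBl addrA subrK.
Qed.

Lemma has_derivM (f g : R -> R) t (f' g' : R) :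
  has_deriv f t f' -> has_deriv g t g' ->
  has_deriv (fun s => f s * g s) t (f t * g' + f' * g t).
Proof. exact: has_derivZ. Qed.

Lemma has_derivV (f : R -> R) t (f' : R) : f t != 0 -> has_deriv f t f' ->
  has_deriv (fun s => (f s)^-1) t (- f' * (f t) ^- 2).
Proof.
move=> ft0 hf; have /within_from_dnbhs fc := has_deriv_cont hf.
move: hf => /has_derivP hf; apply/has_derivP.
have fv : (f s)^-1 @[s --> within `[t0, +oo[ t^'] --> (f t)^-1 by exact: cvgV.
have h : - ((s - t)^-1 *: (f s - f t)) * (f s)^-1 * (f t)^-1
    @[s --> within `[t0, +oo[ t^'] --> - f' * f t ^- 2.
  rewrite -exprVn expr2 mulrA.
  by apply: cvgM; [apply: cvgM => //; exact: cvgN|exact: cvg_cst].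
apply: (cvg_trans _ h); apply: near_eq_cvg.
have : \forall s \near within `[t0, +oo[ t^', f s != 0.
  by apply: (cvgr_neq0 _ fc).
apply: filterS => s fs0 /=.
rewrite -[_ *: _ in LHS]/(_ * _) -[_ *: _ in RHS]/(_ * _).
by move: (s - t)^-1 => c; field; rewrite ft0 fs0.
Qed.

End HalfLineCalculus.
Arguments has_deriv {R} t0 {V}.
Arguments cont_from {R} t0 {V}.

Lemma subrBB (V : zmodType) (v u w : V) : u - w = (u - v) - (w - v).
Proof. by rewrite opprB addrA subrK. Qed.

Lemma subrBB_exchange (V : zmodType) (u v w z : V) :
  (u - v) - (w - z) = (u - w) - (v - z).
Proof. by rewrite !opprB addrACA [RHS]addrACA; congr (_ + _); exact: addrC. Qed.

(** * Interval induction and mean value inequalities *)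

Section Cousin.
Context {R : realType}.

(** Compactness of [[a, b]] as an induction: the supremum [c] of the points reachable from [a] is
    itself reached by the local clause at [c], which also steps beyond [c] unless [c = b]. The local
    clause only concerns intervals containing their tag [t], the form in which derivatives give
    estimates. *)
Lemma cousin (Q : R -> R -> Prop) (a b : R) : a <= b ->
  (forall x y z, a <= x -> x <= y -> y <= z -> z <= b ->
    Q x y -> Q y z -> Q x z) ->
  (forall t, a <= t -> t <= b -> exists2 d, 0 < d & forall x y,
    a <= x -> x <= t -> t <= y -> y <= b -> t - d < x -> y < t + d -> Q x y) ->
  Q a b.
Proof.
move=> ab Qtrans Qloc.
pose S := [set t | [/\ a <= t, t <= b & Q a t]].
have Sa : S a.
  by have [d d0 Qa] := Qloc a (lexx a) ab; split => //; apply: Qa => //; lra.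
have Sub : has_ubound S by exists b => t [].
have hS : has_sup S by split; first by exists a.
pose c := sup S.
have ac : a <= c by exact: ub_le_sup.
have cb : c <= b by apply: ge_sup; [exists a|move=> t []].
have [d d0 Qc] := Qloc c ac cb.
have [t [at_ tb Qat] ct] := sup_adherent d0 hS; rewrite -/c in ct.
have tc : t <= c by exact: ub_le_sup.
have [cb'|cb'] := eqVneq c b.
  by apply: (Qtrans a t b) => //; apply: Qc => //; rewrite ?cb'//; lra.
have {}cb' : c < b by rewrite lt_neqAle cb'.
pose y := Num.min b (c + d / 2).
have cy : c < y by rewrite lt_min cb'/=; lra.
have yb : y <= b by rewrite ge_min lexx.
have yd : y <= c + d / 2 by rewrite ge_min lexx orbT.
suff : S y by move=> /(ub_le_sup Sub); rewrite leNgt cy.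
split => //; first by lra.
by apply: (Qtrans a t y) => //; [lra|apply: Qc => //; lra].
Qed.

End Cousin.

Section MeanValue.
Context {R : realType} {t0 : R}.

Lemma nearP_dist (P : R -> Prop) (t : R) :
  (\forall s \near t, P s) <-> exists2 d, 0 < d & forall s, `|s - t| < d -> P s.
Proof.
split=> [/nbhs_ballP[d /= d0 h]|[d d0 h]].
  by exists d => // s st; apply: h; rewrite /ball/= distrC.
by apply/nbhs_ballP; exists d => //= s st; apply: h; rewrite distrC.
Qed.

(** Straddle estimate: both endpoints are compared with the tag [t] between them, and
    [|x - t| + |y - t| = y - x], so the errors of [f] and [g], half of [e] each, add up to
    [e (y - x)]. *)
Lemma has_deriv_increment_le (V : normedModType R) (f : R -> V) (g : R -> R)
    t l (m e : R) : has_deriv t0 f t l -> has_deriv t0 g t m -> `|l| <= m -> 0 < e ->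
  exists2 d, 0 < d & forall x y, t0 <= x -> x <= t -> t <= y ->
    t - d < x -> y < t + d -> `|f y - f x| <= g y - g x + e * (y - x).
Proof.
move=> hf hg lm e0.
have e20 : 0 < e / 2 by lra.
have /nearP_dist[d1 d10 h1] := hf _ e20.
have /nearP_dist[d2 d20 h2] := hg _ e20.
exists (Num.min d1 d2); first by rewrite lt_min d10.
move=> x y t0x xt ty; rewrite ltrBlDr -ltrBlDl lt_min => /andP[x1 x2].
rewrite -ltrBlDl lt_min => /andP[y1 y2].
have [fx gx] : `|f x - f t - (x - t) *: l| <= e / 2 * `|x - t| /\
    `|g x - g t - (x - t) * m| <= e / 2 * `|x - t|.
  by split; [apply: h1|apply: h2] => //; rewrite ler0_norm; lra.
have [fy gy] : `|f y - f t - (y - t) *: l| <= e / 2 * `|y - t| /\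
    `|g y - g t - (y - t) * m| <= e / 2 * `|y - t|.
  have t0y : t0 <= y by lra.
  by split; [apply: h1|apply: h2] => //; rewrite ger0_norm; lra.
have -> : f y - f x = (f y - f t - (y - t) *: l) - (f x - f t - (x - t) *: l)
    + (y - x) *: l.
  have -> : y - x = (y - t) - (x - t) by lra.
  rewrite (scalerBl (y - t)) (subrBB (f t) (f y)); move: (f y - _) (f x - _) => u w.
  by rewrite addrAC addrA subrK -subrBB.
apply: le_trans (ler_normD _ _) _; rewrite normrZ (@ger0_norm _ (y - x)); last lra.
have := ler_normB (f y - f t - (y - t) *: l) (f x - f t - (x - t) *: l).
have : (y - x) * `|l| <= (y - x) * m by apply: ler_wpM2l => //; lra.
move: gx gy fx fy; rewrite (@ler0_norm _ (x - t)) ?(@ger0_norm _ (y - t)); try lra.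
rewrite !ler_norml => /andP[? ?] /andP[? ?].
lra.
Qed.
Lemma mean_value_le (V : normedModType R) (f : R -> V) (g : R -> R)
    (f' : R -> V) (g' : R -> R) a b : t0 <= a -> a <= b ->
  (forall t, a <= t -> t <= b ->
    [/\ has_deriv t0 f t (f' t), has_deriv t0 g t (g' t) & `|f' t| <= g' t]) ->
  `|f b - f a| <= g b - g a.
Proof.
move=> t0a ab h; apply/ler_addgt0Pr => e e0.
have ba : 0 < b - a + 1 by lra.
(* The [+ 1] keeps the denominator positive when [a = b]. *)
pose e' := e / (b - a + 1).
have e'0 : 0 < e' by rewrite divr_gt0.
suff : `|f b - f a| <= g b - g a + e' * (b - a).
  move=> /le_trans; apply; rewrite lerD2l /e' -mulrA ler_piMr ?(ltW e0)//.
  by rewrite ler_pdivrMl//; lra.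
apply: (@cousin _ (fun x y => `|f y - f x| <= g y - g x + e' * (y - x))) => //.
  move=> x y z ax xy yz zb; have := ler_normD (f z - f y) (f y - f x).
  by rewrite addrA subrK; lra.
move=> t at_ tb; have [ft gt fg] := h t at_ tb.
have [d d0 hd] := has_deriv_increment_le ft gt fg e'0.
by exists d => // x y ax xt ty yb; apply: hd => //; lra.
Qed.

Lemma cont_from_bounded (V : normedModType R) (f : R -> V) a b :
  t0 <= a -> a <= b -> (forall t, a <= t -> t <= b -> cont_from t0 f t) ->
  exists M, forall t, a <= t -> t <= b -> `|f t| <= M.
Proof.
move=> t0a ab h.
apply: (@cousin _ (fun x y => exists M, forall t, x <= t -> t <= y -> `|f t| <= M)) => //.
  move=> x y z ax xy yz zb [M1 h1] [M2 h2]; exists (Num.max M1 M2) => t xt tz.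
  by rewrite le_max; have [/(h1 _ xt) ->//|/ltW/h2 ->//] := leP t y; rewrite orbT.
move=> t at_ tb; have /cont_fromP/(_ _ ltr01)/nearP_dist[d d0 hd] := h t at_ tb.
exists d => // x y ax xt ty yb xd yd; exists (1 + `|f t|) => s xs sy.
have /hd : `|s - t| < d by rewrite ltr_norml; lra.
have -> : (t0 <= s) by lra.
move=> /(_ isT) h'; rewrite -(subrK (f t) (f s)).
by apply: le_trans (ler_normD _ _) _; rewrite lerD2r.
Qed.

Lemma is_derive_has_deriv (g : R -> R) t (l : R) :
  is_derive t (1 : R) g l -> has_deriv t0 g t l.
Proof.
move=> [dg gl] e e0.
have /cvgrPdist_le /(_ e e0) : (fun h => h^-1 *: (g (h *: 1 + t) - g t)) @ 0^' --> l.
  by rewrite -gl.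
rewrite near_withinE => /nearP_dist[d d0 hd].
apply/nearP_dist; exists d => // s std _.
have [->|st] := eqVneq s t; first by rewrite !subrr scale0r subr0 !normr0 mulr0.
have := hd (s - t); rewrite subr0 => /(_ std).
have st0 : s - t != 0 by rewrite subr_eq0.
move=> /(_ st0); rewrite [_%:A]mulr1 subrK => h.
have -> : g s - g t - (s - t) *: l = (s - t) * ((s - t)^-1 *: (g s - g t) - l).
  by rewrite mulrBr mulrA divff// mul1r.
by rewrite normrM mulrC ler_wpM2r// distrC.
Qed.

Lemma has_deriv_expR (M K a t : R) :
  has_deriv t0 (fun s => M * expR (K * (s - a))) t (M * K * expR (K * (t - a))).
Proof.
apply: is_derive_has_deriv.
have h : is_derive t (1 : R) (fun s => K * (s - a)) K.
  by apply: is_derive_eq; rewrite subr0 [LHS]mulr1.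
have he := @is_derive1_comp _ expR (fun s : R => K * (s - a)) t _ _
  (is_derive_expR (K * (t - a))) h.
have h' := is_deriveZ M he.
by apply: is_derive_eq; rewrite [LHS]mulrCA [LHS]mulrC mulrAC mulrC mulrA.
Qed.

Lemma has_deriv_affine (V : normedModType R) (v : V) (a t : R) :
  has_deriv t0 (fun s => (s - a) *: v) t v.
Proof.
move=> e e0; apply/nearP_dist; exists 1 => // s _ _.
rewrite -scalerBl opprB addrA subrK subrr normr0.
by rewrite mulr_ge0// ltW.
Qed.

End MeanValue.

(** * Primitives of continuous Banach-valued curves *)

Section Primitive.
Context {R : realType} {t0 : R} {E : completeNormedModType R}.
Implicit Types (g G : R -> E) (e : R).

(** A straddle condition with a radius depending on the tag: such functions glue at a common
    endpoint, a single linear function works near each point, and two of them on one interval are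
    compared by [cousin]. *)
Let approx_primitive g e (x y : R) G := forall t, x <= t -> t <= y ->
  exists2 d, 0 < d & forall u v, x <= u -> u <= t -> t <= v -> v <= y ->
    t - d < u -> v < t + d -> `|G v - G u - (v - u) *: g t| <= e * (v - u).

Let approx_primitive_exists g e T : t0 <= T -> 0 < e ->
  (forall t, t0 <= t -> cont_from t0 g t) -> exists G, approx_primitive g e t0 T G.
Proof.
move=> t0T e0 gc; apply: (@cousin _ (fun x y => exists G, approx_primitive g e x y G)) => //.
  move=> x y z ax xy yz zb [G1 h1] [G2 h2].
  pose G u := if u <= y then G1 u else G2 u - G2 y + G1 y.
  have GE u : y <= u -> G u = G2 u - G2 y + G1 y.
    move=> yu; have [uy|uy] := leP u y; last by rewrite /G leNgt uy.
    by rewrite (_ : u = y) /G ?lexx ?subrr ?add0r//; apply/eqP; rewrite eq_le uy yu.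
  have GE' u : u <= y -> G u = G1 u by rewrite /G => ->.
  exists G => t xt tz; have [ty|ty|ty] := ltgtP t y.
  - have [d d0 hd] := h1 t xt (ltW ty).
    exists (Num.min d (y - t)); first by rewrite lt_min d0/=; lra.
    move=> u v xu ut tv vz; rewrite ltrBlDr -ltrBlDl -(ltrBlDl v) !lt_min.
    move=> /andP[tu1 tu2] /andP[vt1 vt2].
    by rewrite !GE'; [apply: hd => //; lra|lra|lra].
  - have [d d0 hd] := h2 t (ltW ty) tz.
    exists (Num.min d (t - y)); first by rewrite lt_min d0/=; lra.
    move=> u v xu ut tv vz; rewrite ltrBlDr -ltrBlDl -(ltrBlDl v) !lt_min.
    move=> /andP[tu1 tu2] /andP[vt1 vt2].
    rewrite !GE; [|lra|lra]; rewrite opprD addrACA subrr addr0 opprB addrA subrK.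
    by apply: hd => //; lra.
  - have [d1 d10 hd1] := h1 y xy (lexx y).
    have [d2 d20 hd2] := h2 y (lexx y) yz.
    rewrite {}ty.
    exists (Num.min d1 d2); first by rewrite lt_min d10.
    move=> u v xu ut tv vz; rewrite ltrBlDr -ltrBlDl -(ltrBlDl v) !lt_min.
    move=> /andP[tu1 tu2] /andP[vt1 vt2].
    rewrite GE// GE'//.
    have -> : G2 v - G2 y + G1 y - G1 u - (v - u) *: g y =
      (G2 v - G2 y - (v - y) *: g y) + (G1 y - G1 u - (y - u) *: g y).
      have -> : v - u = (v - y) + (y - u) by lra.
      by rewrite scalerDl opprD -(addrA _ (G1 y)) addrACA.
    apply: le_trans (ler_normD _ _) _.
    have -> : e * (v - u) = e * (v - y) + e * (y - u) by lra.
    by apply: lerD; [apply: hd2 => //; lra|apply: hd1 => //; lra].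
move=> t t0t tT; have /cont_fromP/(_ _ e0)/nearP_dist[d d0 hd] := gc t t0t.
exists d => // x y ax xt ty yb xd yd; exists (fun u => u *: g t) => s xs sy.
exists 1 => // u v xu us sv vy _ _; rewrite -scalerBl -scalerBr normrZ ger0_norm; last lra.
rewrite mulrC distrC; apply: ler_wpM2r; first lra.
by apply: hd; [rewrite ltr_norml; lra|lra].
Qed.

Let approx_primitive_close g e e' x y G G' : x <= y ->
  approx_primitive g e x y G -> approx_primitive g e' x y G' ->
  forall u v, x <= u -> u <= v -> v <= y ->
  `|(G v - G u) - (G' v - G' u)| <= (e + e') * (v - u).
Proof.
move=> xy h h' u v xu uv vy.
apply: (@cousin _ (fun u v => `|(G v - G u) - (G' v - G' u)| <= (e + e') * (v - u))) => //.
  move=> a b c ua ab bc cv.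
  have := ler_normD (G c - G b - (G' c - G' b)) (G b - G a - (G' b - G' a)).
  rewrite addrACA -opprD addrA subrK (addrA (G' c - G' b)) subrK => hh h1 h2.
  by apply: le_trans hh _; lra.
move=> t ut tv; have [||d d0 hd] := h t; [lra|lra|].
have [||d' d'0 hd'] := h' t; [lra|lra|].
exists (Num.min d d'); first by rewrite lt_min d0.
move=> a b ua at_ tb bv; rewrite ltrBlDr -ltrBlDl -(ltrBlDl b) !lt_min.
move=> /andP[ta1 ta2] /andP[tb1 tb2].
have -> : G b - G a - (G' b - G' a) =
  (G b - G a - (b - a) *: g t) - (G' b - G' a - (b - a) *: g t).
  exact: subrBB.
apply: le_trans (ler_normB _ _) _; rewrite mulrDl.
by apply: lerD; [apply: hd => //; lra|apply: hd' => //; lra].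
Qed.

Lemma primitive_exists g : (forall t, t0 <= t -> cont_from t0 g t) ->
  exists G, G t0 = 0 /\ forall t, t0 <= t -> has_deriv t0 G t (g t).
Proof.
move=> gc; pose e n : R := n.+1%:R^-1.
have e_gt0 n : 0 < e n by rewrite invr_gt0.
have e_cvg : e @ \oo --> 0 by exact: cvg_harmonic.
have e_near c : 0 < c -> \forall n \near \oo, e n <= c.
  by move=> c0; apply: (cvgr_le _ e_cvg).
(* The index [n] governs both the precision [e n] and the interval [[t0, t0 + n]], so one sequence
   yields a primitive on the whole half-line. *)
have /choice[G' hG'] : forall n, exists G, approx_primitive g (e n) t0 (t0 + n%:R) G.
  by move=> n; apply: approx_primitive_exists => //; rewrite lerDl.
pose G n t := G' n t - G' n t0.
have hG m n u v : t0 <= u -> u <= v -> v <= t0 + m%:R -> (m <= n)%N ->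
    `|(G m v - G m u) - (G n v - G n u)| <= (e m + e n) * (v - u).
  move=> t0u uv vm mn; rewrite /G !(opprB _ (G' _ t0)) !addrA !subrK.
  apply: (@approx_primitive_close g _ _ t0 (t0 + m%:R)) => //; first by rewrite lerDl.
  move=> t t0t tm; have mn' : t0 + m%:R <= t0 + n%:R by rewrite lerD2l ler_nat.
  have [//||d d0 hd] := hG' n t; first exact: le_trans tm mn'.
  by exists d => // u' v' *; apply: hd => //; exact: le_trans mn'.
have G_cvg t : t0 <= t -> cvg ((fun n => G n t) @ \oo).
  move=> t0t; apply/cauchy_cvgP/cauchy_exP => _/posnumP[r].
  have c0 : 0 < r%:num / 4 / (t - t0 + 1) by rewrite divr_gt0// ltr_pwDr// subr_ge0.
  have [N _ HN] := e_near _ c0.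
  have [N' tN'] : exists N', t - t0 <= N'%:R.
    by exists (Num.truncn (t - t0)).+1; rewrite ltW// truncnS_gt.
  pose m := maxn N N'; exists (G m t); exists m => // n /= mn.
  rewrite -ball_normE/=.
  have Gt0 k : G k t0 = 0 by rewrite /G subrr.
  have tm : t <= t0 + m%:R.
    by rewrite -lerBlDl (le_trans tN')// ler_nat leq_maxr.
  have := hG m n t0 t (lexx _) t0t tm mn; rewrite !Gt0 !subr0.
  move=> /le_lt_trans; apply.
  have := HN m (leq_maxl _ _); have := HN n (leq_trans (leq_maxl _ _) mn).
  rewrite /= !ler_pdivlMr; try lra; move=> h1 h2.
  have := mulr_ge0 (ltW (e_gt0 m)) (_ : 0 <= t - t0).
  have : 0 < r%:num by [].
  move: (e_gt0 n) (e_gt0 m) h1 h2; move: (e m) (e n) (r%:num) => a b c.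
  nra.
pose Gl t := lim ((fun n => G n t) @ \oo).
have hGl m u v : t0 <= u -> u <= v -> v <= t0 + m%:R ->
    `|(Gl v - Gl u) - (G m v - G m u)| <= 2 * e m * (v - u).
  move=> t0u uv vm; rewrite distrC.
  have L : (fun n => `|(G m v - G m u) - (G n v - G n u)|) @ \oo -->
      `|(G m v - G m u) - (Gl v - Gl u)|.
    apply: cvg_norm; apply: cvgB; first exact: cvg_cst.
    by apply: cvgB; apply: G_cvg; lra.
  apply: (ler_cvg_to L (cvg_cst _)); exists m => // n /= mn.
  apply: le_trans (hG m n u v t0u uv vm mn) _; apply: ler_wpM2r; first lra.
  suff : e n <= e m by lra.
  by rewrite lef_pV2 ?posrE// ler_nat.
exists Gl; split.
  rewrite /Gl (_ : (fun n => G n t0) = fun=> 0) ?lim_cst//.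
  by apply/funext => n; rewrite /G subrr.
move=> t t0t r r0.
have [N _ HN] := e_near (r / 3) (divr_gt0 r0 (ltr0n _ 3)).
have [N' tN'] : exists N', t + 1 - t0 <= N'%:R.
  by exists (Num.truncn (t + 1 - t0)).+1; rewrite ltW// truncnS_gt.
pose m := maxn N N'; have em : e m <= r / 3 by apply: HN; exact: leq_maxl.
have tm : t + 1 <= t0 + m%:R.
  by rewrite -lerBlDl (le_trans tN')// ler_nat leq_maxr.
have [//||d d0 hd] := hG' m t; first lra.
have main u v : t0 <= u -> u <= t -> t <= v -> t - d < u -> v < t + d ->
    v < t + 1 -> `|Gl v - Gl u - (v - u) *: g t| <= r * (v - u).
  move=> t0u ut tv du vd v1.
  have -> : Gl v - Gl u - (v - u) *: g t =
    ((Gl v - Gl u) - (G m v - G m u)) + (G' m v - G' m u - (v - u) *: g t).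
    by rewrite /G -subrBB [in RHS]addrA subrK.
  apply: le_trans (ler_normD _ _) _.
  have : 0 <= (r / 3 - e m) * (v - u) by apply: mulr_ge0; lra.
  have := hGl m u v; have := hd u v.
  move=> h1 h2.
  have {}h1 := h1 t0u ut tv _ du vd; have {}h2 := h2 t0u _ _.
  have : `|Gl v - Gl u - (G m v - G m u)| <= 2 * e m * (v - u) by apply: h2 => //; lra.
  have : `|G' m v - G' m u - (v - u) *: g t| <= e m * (v - u) by apply: h1 => //; lra.
  lra.
apply/nearP_dist; exists (Num.min d 1); first by rewrite lt_min d0/=.
move=> s; rewrite lt_min !ltr_norml => /andP[/andP[sd ds] /andP[s1 s2]] t0s.
have [ts|st] := leP t s.
  by rewrite ger0_norm; [apply: main => //; lra|lra].
rewrite ltr0_norm; last lra.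
have -> : Gl s - Gl t - (s - t) *: g t = - (Gl t - Gl s - (t - s) *: g t).
  by rewrite !opprB -(opprB s t) scaleNr [RHS]addrC.
by rewrite normrN opprB; apply: main => //; lra.
Qed.

End Primitive.

(** * Cauchy-Lipschitz theorem in Banach spaces *)

Section CauchyLipschitz.
Context {R : realType} {t0 : R} {E : completeNormedModType R}.
Variable f : R -> E -> E.
Hypothesis f_cont : forall X t, t0 <= t -> cont_from t0 (f ^~ X) t.
Hypothesis f_lip : forall T, exists2 L : R, 0 <= L &
  forall t, t0 <= t -> t <= T -> forall X Y, `|f t X - f t Y| <= L * `|X - Y|.

Lemma cont_from_comp_lip (X : R -> E) t : t0 <= t -> cont_from t0 X t ->
  cont_from t0 (fun s => f s (X s)) t.
Proof.
move=> t0t /cont_fromP hX; apply/cont_fromP => e e0.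
have [L L0 hL] := f_lip (t + 1).
have /cont_fromP := @f_cont (X t) t t0t.
have e20 : 0 < e / 2 by lra.
have d0 : 0 < e / 2 / (L + 1) by rewrite divr_gt0//; lra.
move=> /(_ _ e20)/nearP_dist[d1 d10 h1].
have /nearP_dist[d2 d20 h2] := hX _ d0.
apply/nearP_dist; exists (Num.min (Num.min d1 d2) 1).
  by rewrite !lt_min d10 d20 ltr01.
move=> s; rewrite !lt_min => /andP[/andP[s1 s2] s3] t0s.
rewrite -(subrK (f s (X t)) (f s (X s))) -addrA.
apply: le_trans (ler_normD _ _) _.
rewrite [leRHS](_ : e = e / 2 + e / 2); last lra.
apply: lerD; last exact: h1.
apply: (le_trans (hL s t0s _ _ _)); first by move: s3; rewrite ltr_norml; lra.
have := h2 s s2 t0s; rewrite ler_pdivlMr; last lra.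
by have := normr_ge0 (X s - X t); nra.
Qed.

Lemma has_deriv_cst_add (x : E) (G : R -> E) t l :
  has_deriv t0 G t l -> has_deriv t0 (fun s => x + G s) t l.
Proof. by move=> h; rewrite -(add0r l); apply: has_derivD => //; exact: has_deriv_cst. Qed.

Theorem cauchy_lipschitz (X0 : E) : exists X : R -> E,
  X t0 = X0 /\ forall t, t0 <= t -> has_deriv t0 X t (f t (X t)).
Proof.
(* [Phi] is the Picard operator. On a discontinuous curve it returns the curve itself, a value that
   never matters since the iterates and their limit are continuous. *)
have /choice[Phi hPhi] : forall X : R -> E, exists Y : R -> E,
    (forall t, t0 <= t -> cont_from t0 X t) ->
    Y t0 = X0 /\ forall t, t0 <= t -> has_deriv t0 Y t (f t (X t)).
  move=> X; have [h|nh] := pselect (forall t, t0 <= t -> cont_from t0 X t); last by exists X.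
  have [t t0t|G [G0 hG]] := @primitive_exists _ t0 _ (fun s => f s (X s)).
    by apply: cont_from_comp_lip => //; exact: h.
  exists (fun s => X0 + G s) => _; split; first by rewrite G0 addr0.
  by move=> t /hG; exact: has_deriv_cst_add.
pose X n := iter n Phi (fun=> X0).
have X_cont n t : t0 <= t -> cont_from t0 (X n) t.
  elim: n t => [|n IH] t t0t /=; first exact: (has_deriv_cont (has_deriv_cst _ _)).
  by have [_ /(_ _ t0t)/has_deriv_cont] := hPhi _ IH.
have X_init n : X n t0 = X0 by case: n => //= n; case: (hPhi _ (X_cont n)).
have X_deriv n t : t0 <= t -> has_deriv t0 (X n.+1) t (f t (X n t)).
  by have [_] := hPhi _ (X_cont n); apply.
(* On [t0, T] successive iterates differ by O(2^-n), in the norm weighted by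
   exp (- 2 L (t - t0)). *)
have X_step T : exists2 C : R, 0 <= C & forall n t, t0 <= t -> t <= T ->
    `|X n.+1 t - X n t| <= C * 2^-1 ^+ n.
  have [Tt0|t0T] := ltP T t0; first by exists 0 => // n t *; exfalso; lra.
  have [L L0 hL] := f_lip T.
  have [M hM] : exists M, forall t, t0 <= t -> t <= T -> `|X 1 t - X 0 t| <= M.
    apply: cont_from_bounded t0T _ => // t t0t tT.
    by apply: (has_deriv_cont (has_derivB (X_deriv 0 _ t0t) (has_deriv_cst _ _))).
  have M0 : 0 <= M by apply: le_trans (hM t0 (lexx _) t0T).
  have main n t : t0 <= t -> t <= T ->
      `|X n.+1 t - X n t| <= M * 2^-1 ^+ n * expR (2 * L * (t - t0)).
    elim: n t => [|n IH] t t0t tT.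
      rewrite expr0 mulr1; apply: le_trans (hM _ t0t tT) _.
      rewrite ler_peMr// -[leLHS]expR0 ler_expR; apply: mulr_ge0; last lra.
      by rewrite mulr_ge0.
    (* The rate is [2 * L] rather than [L]: the derivative of [g] is then [L] times the bound at
       step [n], and this is where the factor one half is gained. *)
    pose g s := M * 2^-1 ^+ n.+1 * expR (2 * L * (s - t0)).
    have : `|(X n.+2 t - X n.+1 t) - (X n.+2 t0 - X n.+1 t0)| <= g t - g t0.
      apply: (@mean_value_le _ t0 _ (fun s => X n.+2 s - X n.+1 s) g
        (fun s => f s (X n.+1 s) - f s (X n s))
        (fun s => M * 2^-1 ^+ n.+1 * (2 * L) * expR (2 * L * (s - t0)))) => // s t0s st.
      split; first exact: has_derivB (X_deriv _ _ _) (X_deriv _ _ _).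
        exact: has_deriv_expR.
      have sT : s <= T by lra.
      apply: le_trans (hL _ t0s sT _ _) _.
      apply: le_trans (ler_wpM2l L0 (IH _ t0s sT)) _.
      by rewrite exprS le_eqVlt; apply/orP; left; apply/eqP; field.
    rewrite !X_init subrr subr0 => /le_trans; apply.
    by rewrite lerBlDr lerDl !mulr_ge0// ?expR_ge0// exprn_ge0.
  exists (M * expR (2 * L * (T - t0))); first by rewrite mulr_ge0// expR_ge0.
  move=> n t t0t tT; apply: le_trans (main n t t0t tT) _.
  rewrite mulrAC; apply: ler_wpM2r; first by rewrite exprn_ge0.
  apply: ler_wpM2l => //; rewrite ler_expR; apply: ler_wpM2l; first by rewrite mulr_ge0.
  by rewrite lerD2r.
have X_close T : exists2 C : R, 0 <= C & forall m n t, (m <= n)%N -> t0 <= t -> t <= T ->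
    `|X n t - X m t| <= C * 2^-1 ^+ m.
  have [C C0 hC] := X_step T; exists (2 * C); first by rewrite mulr_ge0.
  move=> m n t mn t0t tT.
  suff : `|X n t - X m t| <= 2 * C * (2^-1 ^+ m - 2^-1 ^+ n).
    by move=> /le_trans; apply; rewrite ler_wpM2l ?mulr_ge0// gerBl exprn_ge0.
  elim: n mn => [|n IH]; first by rewrite leqn0 => /eqP ->; rewrite !subrr normr0 mulr0.
  rewrite leq_eqVlt => /orP[/eqP ->|mn]; first by rewrite !subrr normr0 mulr0.
  rewrite -(subrK (X n t) (X n.+1 t)) -addrA.
  apply: le_trans (ler_normD _ _) _.
  apply: le_trans (lerD (hC n t t0t tT) (IH mn)) _.
  by rewrite exprS; lra.
have half_cvg (C : R) : 0 <= C -> forall e : R, 0 < e ->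
    \forall n \near \oo, C * 2^-1 ^+ n <= e.
  move=> C0 e e0; have h : (fun n => C * (2^-1 : R) ^+ n) @ \oo --> C * 0.
    apply: cvgM; first exact: cvg_cst.
    by apply: cvg_expr; rewrite ger0_norm ?invr_ge0// invf_lt1// ltr1n.
  by apply: (cvgr_le _ h); rewrite mulr0.
have X_cvg t : t0 <= t -> cvg ((fun n => X n t) @ \oo).
  move=> t0t; apply/cauchy_cvgP/cauchy_exP => _/posnumP[r].
  have [C C0 hC] := X_close t.
  have r20 : 0 < r%:num / 2 by [].
  have [N _ HN] := half_cvg C C0 _ r20.
  exists (X N t); exists N => // n /= Nn.
  rewrite -ball_normE/= distrC (le_lt_trans (hC N n t Nn t0t (lexx _)))//.
  by rewrite (le_lt_trans (HN N (leqnn N)))// ltr_pdivrMr// ltr_pMr// ltr1n.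
pose Xl t := lim ((fun n => X n t) @ \oo).
have Xl_close T : exists2 C : R, 0 <= C & forall m t, t0 <= t -> t <= T ->
    `|Xl t - X m t| <= C * 2^-1 ^+ m.
  have [C C0 hC] := X_close T; exists C => // m t t0t tT.
  have L : (fun n => `|X n t - X m t|) @ \oo --> `|Xl t - X m t|.
    by apply: cvg_norm; apply: cvgB; [exact: X_cvg|exact: cvg_cst].
  by apply: (ler_cvg_to L (cvg_cst _)); exists m => // n /= mn; exact: hC.
have Xl_cont t : t0 <= t -> cont_from t0 Xl t.
  move=> t0t; apply/cont_fromP => e e0.
  have [C C0 hC] := Xl_close (t + 1).
  have e30 : 0 < e / 3 by lra.
  have [N _ /(_ N (leqnn N)) /= HN] := half_cvg C C0 _ e30.
  have /cont_fromP/(_ _ e30)/nearP_dist[d d0 hd] := X_cont N t t0t.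
  apply/nearP_dist; exists (Num.min d 1); first by rewrite lt_min d0/=.
  move=> s; rewrite lt_min => /andP[sd s1] t0s.
  have st1 : s <= t + 1 by move: s1; rewrite ltr_norml; lra.
  have h1 := hC N s t0s st1; have h2 := hC N t t0t (ltac:(lra)); have h3 := hd s sd t0s.
  have -> : Xl s - Xl t = (Xl s - X N s) + (X N s - X N t) - (Xl t - X N t).
    by rewrite addrA subrK -subrBB.
  apply: le_trans (ler_normB _ _) _; have := ler_normD (Xl s - X N s) (X N s - X N t).
  lra.
have [Yt0 hY] := hPhi _ Xl_cont.
(* [Phi Xl] and [X N.+1] have derivatives within [L * C * 2^-1 ^+ N] of each other, so [X N.+1]
   converges to [Phi Xl] as well as to [Xl]. *)
have XY t : t0 <= t -> Phi Xl t = Xl t.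
  move=> t0t; have [C C0 hC] := Xl_close t; have [L L0 hL] := f_lip t.
  apply/eqP; rewrite -subr_eq0 -normr_le0; apply/ler_addgt0Pr => e e0; rewrite add0r.
  have D0 : 0 <= L * C * (t - t0) + C by rewrite addr_ge0// !mulr_ge0//; lra.
  have [N _ HN] := half_cvg _ D0 e e0.
  apply: le_trans (HN N (leqnn N)) => /=; rewrite mulrDl.
  rewrite -(subrK (X N.+1 t) (Phi Xl t)) -addrA; apply: le_trans (ler_normD _ _) _.
  apply: lerD; last first.
    rewrite distrC; apply: le_trans (hC N.+1 t t0t (lexx _)) _.
    by rewrite ler_wpM2l// exprS ler_piMl ?exprn_ge0// invf_le1// ler1n.
  have := @mean_value_le _ t0 _ (fun s => Phi Xl s - X N.+1 s)
    (fun s => (s - t0) * (L * C * 2^-1 ^+ N))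
    (fun s => f s (Xl s) - f s (X N s)) (fun=> L * C * 2^-1 ^+ N) t0 t (lexx _) t0t.
  cbv beta; rewrite Yt0 X_init !subrr subr0 mul0r subr0 => h.
  rewrite mulrAC mulrC; apply: h => s t0s st; split.
  - by apply: has_derivB; [exact: hY|exact: X_deriv].
  - exact: (has_deriv_affine (V := R)).
  - apply: le_trans (hL _ t0s st _ _) _; rewrite -mulrA ler_wpM2l//.
    exact: hC.
exists Xl; split; first by rewrite -XY.
by move=> t t0t; apply: (eq_has_deriv t0t XY); exact: hY.
Qed.

End CauchyLipschitz.

(** * Completeness of the product space carrying the first-order system *)

Section ProductComplete.
Context {R : realType} {U V : completeNormedModType R}.

HB.instance Definition _ := Pointed.on (U * V)%type.
HB.instance Definition _ := Uniform.on (U * V)%type.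

Let prod_cauchy_cvg (F : set_system (U * V : puniformType)%type) :
  ProperFilter F -> cauchy F -> cvg F.
Proof.
move=> PF /cauchyP Fc.
have /cauchy_cvgP/cvg_ex[/= a Fa] : cauchy (fst @ F).
  apply: cauchy_exP => e e0; have [p Fp] := Fc e e0.
  exists p.1; change (F [set q | ball p.1 e q.1]).
  by apply: (@filterS _ F _ _ _ _ Fp) => q [].
have /cauchy_cvgP/cvg_ex[/= b Fb] : cauchy (snd @ F).
  apply: cauchy_exP => e e0; have [p Fp] := Fc e e0.
  exists p.2; change (F [set q | ball p.2 e q.2]).
  by apply: (@filterS _ F _ _ _ _ Fp) => q [].
apply/cvg_ex; exists (a, b).
apply: (cvg_trans _ (cvg_pair Fa Fb)) => P h.
by apply: (@filterS _ F _ _ _ _ h) => -[].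

Qed.

HB.instance Definition _ :=
  Uniform_isComplete.Build (U * V)%type prod_cauchy_cvg.
End ProductComplete.

(** * Almost everywhere differentiability of Lipschitz curves *)

#[local] Instance ae_lebesgue_filter (R : realType) :
  Filter (nbhs (almost_everywhere (@lebesgue_measure R))) :=
  ae_filter_ringOfSetsType _.

Section LipschitzDensity.
Context {R : realType}.
Notation mu := (@lebesgue_measure R).

Lemma lebesgue_stieltjes_oc (G : cumulative R R) (x y : R) : x <= y ->
  lebesgue_stieltjes_measure G `]x, y]%classic = (G y - G x)%:E.
Proof.
move=> xy; rewrite /lebesgue_stieltjes_measure /measure_extension/=.
by rewrite measurable_mu_extE/= ?wlength_itv_bnd//; exact: is_ocitv.
Qed.

(* The Lebesgue-Stieltjes measures of (x + h x) / 2 and (x - h x) / 2 add up to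
   Lebesgue measure, hence are absolutely continuous. *)
Lemma lipschitz_half_density (h : R -> R) (a b : R) : a <= b ->
  (forall x y, `|h x - h y| <= `|x - y|) ->
  exists g : R -> R, mu.-integrable setT (EFin \o g) /\
    forall x y, a <= x -> x <= y -> y <= b ->
    (y + h y) / 2 - (x + h x) / 2 = (\int[mu]_(t in `]x, y]) g t)%R.
Proof.
move=> ab hL.
have hN x y : `|(- h x) - (- h y)| <= `|x - y| by rewrite -opprD normrN.
have nd (k : R -> R) : (forall x y, `|k x - k y| <= `|x - y|) ->
    nondecreasing (fun x => (x + k x) / 2).
  move=> kL x y xy; have := kL y x; rewrite (@ger0_norm _ (y - x)); last lra.
  by rewrite ler_norml; lra.
have rc (k : R -> R) : (forall x y, `|k x - k y| <= `|x - y|) ->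
    right_continuous (fun x => (x + k x) / 2).
  move=> kL; apply: right_continuousW => x.
  apply/cvgrPdist_le => e e0; apply/nearP_dist; exists e => // y.
  have := kL y x; rewrite !ler_norml !ltr_norml => k1 k2.
  have : `|y - x| < e by rewrite ltr_norml.
  move: k1; case: (lerP 0 (y - x)) => ?; lra.
pose G1 : cumulative R R := HB.pack (fun x => (x + h x) / 2)
  (isCumulative.Build R _ R _ (nd _ hL) (rc _ hL)).
pose G2 : cumulative R R := HB.pack (fun x => (x + - h x) / 2)
  (isCumulative.Build R _ R _ (nd _ hN) (rc _ hN)).
pose m1 : {measure set (measurableTypeR R) -> \bar R} := lebesgue_stieltjes_measure G1.
pose m2 : {measure set (measurableTypeR R) -> \bar R} := lebesgue_stieltjes_measure G2.
have m1E x y : x <= y -> m1 `]x, y]%classic = (G1 y - G1 x)%:E by exact: lebesgue_stieltjes_oc.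
have m2E x y : x <= y -> m2 `]x, y]%classic = (G2 y - G2 x)%:E by exact: lebesgue_stieltjes_oc.
have mE A : measurable A -> mu A = (m1 A + m2 A)%E.
  move=> mA; rewrite -measure_addE.
  apply: (lebesgue_stieltjes_measure_unique (f := idfun) (mu := measure_add m1 m2)) => //.
  move=> X /ocitvP[->|[[x y] /= xy ->]].
    by rewrite !measure0.
  rewrite -[RHS]/(measure_add m1 m2 _) measure_addE.
  rewrite (m1E _ _ (ltW xy)) (m2E _ _ (ltW xy)) lebesgue_stieltjes_oc ?ltW//= -EFinD.
  by congr EFin; field.
(* Restricting to []a, b]] makes the dominated measure finite for the Radon-Nikodym theorem. *)
have mD : measurable (`]a, b]%classic : set (measurableTypeR R)) by exact: measurable_itv.
have m1D : (m1 `]a, b]%classic < +oo)%E by rewrite m1E// ltry.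
have dom : mfrestr mD m1D `<< mu.
  move=> N N0 A mA AN; apply/eqP; rewrite eq_le measure_ge0 andbT.
  rewrite -(N0 A mA AN) mE// /mfrestr /mrestr.
  apply: (@le_trans _ _ (m1 A)).
    by apply: le_measure; rewrite ?inE//; exact: measurableI.
  by rewrite leeDl// measure_ge0.
have [f [f0 ffin fint fE]] := radon_nikodym_sigma_finite dom.
have fK : EFin \o (fine \o f) = f by apply/funext => x /=; rewrite fineK.
exists (fine \o f); rewrite fK; split=> // x y ax xy yb.
rewrite /Rintegral -[X in (\int[_]_(t in _) X t)%E]/(EFin \o (fine \o f)) fK.
have mxy : measurable (`]x, y]%classic : set (measurableTypeR R)) by exact: measurable_itv.
rewrite -fE//.
transitivity (fine (m1 (`]x, y]%classic `&` `]a, b]%classic))); last by [].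
rewrite setIidl ?m1E// => z/=; rewrite !in_itv/= => /andP[xz zy].
by apply/andP; split; lra.
Qed.

End LipschitzDensity.

Section Rademacher.
Context {R : realType}.
Notation mu := (@lebesgue_measure R).

Lemma ae_has_deriv_integral (g : R -> R) (a : R) :
  (forall y, mu.-integrable `]a, y] (EFin \o g)) -> locally_integrable setT g ->
  {ae mu, forall t, a < t ->
    has_deriv a (fun x => \int[mu]_(t in `]a, x]) g t)%R t (g t)}.
Proof.
move=> gint gloc; have := FTC1 gint gloc.
apply: filterS => t h at_; have [dF <-] := h at_.
by apply: is_derive_has_deriv; rewrite derive1E; exact/derivableP.
Qed.

Lemma has_deriv_near (V : normedModType R) (a : R) (f g : R -> V) t l :
  f t = g t -> (\forall s \near t, f s = g s) -> has_deriv a f t l -> has_deriv a g t l.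
Proof.
move=> ftg fg h e /h; apply: filterS2 fg => s -> + t0s.
by rewrite ftg; apply.
Qed.

Lemma has_deriv_lipschitz_le (V : normedModType R) (a b : R) (f : R -> V) t l :
  a <= t -> t < b -> (forall x y, `|f x - f y| <= `|x - y|) -> has_deriv a f t l -> `|l| <= 1.
Proof.
move=> at_ tb fL h; apply/ler_addgt0Pr => e e0.
have /nearP_dist[d d0 hd] := h e e0.
pose s := t + d / 2.
have st : `|s - t| = d / 2 by rewrite /s addrC addKr ger0_norm//; lra.
have := hd s; rewrite st => /(_ (ltac:(lra)) (ltac:(rewrite /s; lra))).
have := fL s t; rewrite st => fst hst.
have d20 : 0 < d / 2 by lra.
rewrite -(ler_pM2l d20) -{1}st -normrZ.
have := ler_normB (f s - f t) (f s - f t - (s - t) *: l).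
by rewrite subKr; lra.
Qed.

(** [h] is the difference of the halves [(x + h x) / 2] and [(x - h x) / 2], so the difference of
    their densities is a density of [h]; Lebesgue differentiation identifies it with the derivative
    almost everywhere. *)
Lemma lipschitz_density (h : R -> R) (a b : R) : a < b ->
  (forall x y, `|h x - h y| <= `|x - y|) ->
  exists g : R -> R, [/\ measurable_fun setT g, forall x, `|g x| <= 1,
    forall x y, a <= x -> x <= y -> y <= b ->
      `|h y - h x| <= (\int[mu]_(t in `]x, y]) `|g t|)%R &
    {ae mu, forall t, a < t -> t < b -> has_deriv a h t (g t)}].
Proof.
move=> ab hL.
have hN x y : `|(- h x) - (- h y)| <= `|x - y| by rewrite -opprD normrN.
have [g1 [g1int g1E]] := lipschitz_half_density (ltW ab) hL.
have [g2 [g2int g2E]] := lipschitz_half_density (ltW ab) hN.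
pose g x := g1 x - g2 x.
have gint : mu.-integrable setT (EFin \o g).
  have -> : EFin \o g = ((EFin \o g1) \- (EFin \o g2))%E by apply/funext.
  exact: integrableB.
have sub_int (k : R -> R) (D : set R) : measurable D ->
    mu.-integrable setT (EFin \o k) -> mu.-integrable D (EFin \o k).
  by move=> mD; apply: integrableS.
have gE x y : a <= x -> x <= y -> y <= b -> h y - h x = (\int[mu]_(t in `]x, y]) g t)%R.
  move=> ax xy yb; rewrite RintegralB//; [|exact: sub_int..].
  by rewrite -g1E// -g2E//; field.
have FE s : a <= s -> s <= b -> h a + (\int[mu]_(t in `]a, s]) g t)%R = h s.
  by move=> as_ sb; rewrite -(gE a s (lexx a) as_ sb) addrC subrK.
have hderiv : {ae mu, forall t, a < t -> t < b -> has_deriv a h t (g t)}.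
  have := @ae_has_deriv_integral g a (fun y => sub_int _ _ (measurable_itv _) gint)
    (open_integrable_locally openT gint).
  apply: filterS => t ht at_ tb.
  have {}ht := ht at_.
  apply: has_deriv_near (has_deriv_cst_add (h a) ht).
    by apply: FE; exact: ltW.
  apply/nearP_dist; exists (Num.min (t - a) (b - t)).
    by rewrite lt_min; apply/andP; split; lra.
  move=> s; rewrite lt_min !ltr_norml => /andP[/andP[s1 s2] /andP[s3 s4]].
  by apply: FE; lra.
have g_le1 : {ae mu, forall t, a < t -> t < b -> `|g t| <= 1}.
  apply: filterS hderiv => t + at_ tb => /(_ at_ tb).
  exact: (has_deriv_lipschitz_le (ltW at_) tb hL).
pose c x := Num.max (-1) (Num.min 1 (g x)).
have cg x : `|g x| <= 1 -> c x = g x.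
  by rewrite ler_norml /c => /andP[? ?]; rewrite min_r// max_r.
have mg : measurable_fun setT g by apply/measurable_EFinP; case/integrableP : gint.
have mc : measurable_fun setT c.
  apply: measurable_maxr; first exact: measurable_cst.
  by apply: measurable_minr => //; exact: measurable_cst.
exists c; split=> //.
- by move=> x; rewrite ler_norml /c le_max lexx/= ge_max ge_min lexx/= andbT; lra.
- move=> x y ax xy yb; rewrite gE//.
  have mxy : measurable (`]x, y]%classic : set (measurableTypeR R)) by exact: measurable_itv.
  apply: le_trans; first exact: (le_normr_Rintegral mxy (sub_int _ _ mxy gint)).
  have mabs (k : R -> R) : measurable_fun setT k -> forall D : set R, measurable D ->
      measurable_fun D (fun t => (`|k t|)%:E).
    move=> mk D mD; apply/measurable_EFinP; apply: measurableT_comp => //.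
    exact: measurable_funS mk.
  rewrite le_eqVlt; apply/orP; left; apply/eqP; congr fine.
  (* The endpoint [y] may be [b], where [g_le1] says nothing; it is removed as a null set. *)
  rewrite -!integral_itv_bndo_bndc; [|exact: mabs..].
  apply: ae_eq_integral => //; [exact: mabs..|].
  apply: filterS g_le1 => t ht; rewrite /= in_itv/= => /andP[xt ty].
  by rewrite cg//; apply: ht; lra.
- move: hderiv g_le1; apply: filterS2 => t h1 h2 at_ tb.
  by rewrite cg; [exact: h1|exact: h2].
Qed.
End Rademacher.

Section BoundedPrimitive.
Context {R : realType}.
Notation mu := (@lebesgue_measure R).
Variable m : R -> R.
Hypotheses (mm : measurable_fun setT m) (m01 : forall x, 0 <= m x <= 1).

Lemma bounded_integrable (D : set (measurableTypeR R)) :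
  measurable D -> (mu D < +oo)%E -> mu.-integrable D (EFin \o m).
Proof.
move=> mD Dfin; apply: measurable_bounded_integrable => //.
  exact: measurable_funS mm.
exists 1; split => // r r1 x _; have /andP[m0 m1] := m01 x.
by rewrite /= ger0_norm// (le_trans m1)// ltW.
Qed.

Lemma bounded_locally_integrable : locally_integrable setT m.
Proof.
split => //; first exact: openT.
move=> K _ cK; have mK := compact_measurable cK.
have /integrableP[_] : mu.-integrable K (EFin \o m).
  apply: bounded_integrable => //; exact: compact_finite_measure.
by [].
Qed.

Lemma bounded_integrable_oc x y : mu.-integrable `]x, y] (EFin \o m).
Proof.
apply: bounded_integrable; first exact: measurable_itv.
by rewrite lebesgue_measure_itv; case: ifP => _; rewrite ltry.
Qed.

Lemma Rintegral_ocD a x y : a <= x -> x <= y ->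
  (\int[mu]_(t in `]a, y]) m t - \int[mu]_(t in `]a, x]) m t =
   \int[mu]_(t in `]x, y]) m t)%R.
Proof.
by move=> ax xy; apply: Rintegral_itvB; [exact: bounded_integrable_oc|rewrite bnd_simp..].
Qed.

End BoundedPrimitive.

Section HilbertRademacher.
Context {R : realType} {H : completeNormedModType R}.
Context {dot : {dot H for (idfun : R -> R)}} (hdot : induces_norm dot).
Notation mu := (@lebesgue_measure R).
Implicit Types (f : R -> H).

(* If the increments of [f] near [t] are bounded by those of a real function
   with derivative [m], and if the distances from [f] to points [p n] have
   derivatives at [t] whose moduli have supremum [m], then the difference
   quotients of [f] at [t] concentrate near a vector of norm [m]. *)
Lemma has_deriv_of_distances f (M : R -> R) (p : nat -> H) (g : nat -> R) a b t (m : R) :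
  a < t -> t < b ->
  (forall x y, a <= x -> x <= y -> y <= b -> `|f y - f x| <= M y - M x) ->
  has_deriv a M t m -> 0 <= m <= 1 ->
  (forall n, has_deriv a (fun s => `|f s - p n|) t (g n)) ->
  (forall e, 0 < e -> exists n, m - e < `|g n|) ->
  exists l, has_deriv a f t l.
Proof.
move=> at_ tb fM hM /andP[m0 m1] hg gm.
have incr e : 0 < e -> exists2 d, 0 < d & forall s, a <= s -> `|s - t| < d ->
    `|f s - f t| <= (m + e) * `|s - t|.
  move=> e0; have /nearP_dist[d d0 hd] := hM e e0.
  exists (Num.min d (b - t)); first by rewrite lt_min d0/=; lra.
  move=> s as_; rewrite lt_min => /andP[sd sb].
  have := hd s sd as_; rewrite -[_ *: m]/(_ * m).
  move: sd sb; have [ts|st] := leP t s.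
    rewrite (@ger0_norm _ (s - t)); last lra.
    move=> _ sb; rewrite ler_norml => /andP[_ h].
    by have := fM t s (ltW at_) ts (ltac:(lra)); lra.
  rewrite (@ltr0_norm _ (s - t)); last lra.
  move=> _ sb; rewrite ler_norml => /andP[h _].
  by have := fM s t as_ (ltW st) (ltW tb); rewrite distrC; lra.
suff : cvg ((fun s => (s - t)^-1 *: (f s - f t)) @ within `[a, +oo[ t^').
  by move=> /cvg_ex[l hl]; exists l; apply/has_derivP.
have PF := proper_within_from (ltW at_).
apply/cauchy_cvgP/cauchy_exP => e e0.
(* [e / 4] serves the case [m <= eta], where quotients have norm at most [2 * eta]. Otherwise
   [|m u - q|^2] will be at most [6 * m * eta + eta ^+ 2 <= 7 * eta], which [e ^+ 2 / 8] keeps below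
   [e ^+ 2]. *)
pose eta := Num.min 1 (Num.min (e / 4) (e ^+ 2 / 8)).
have eta0 : 0 < eta by rewrite !lt_min ltr01/= !divr_gt0// exprn_gt0.
have eta1 : eta <= 1 by rewrite ge_min lexx.
have eta2 : eta <= e / 4 by rewrite !ge_min lexx orbT.
have eta3 : eta <= e ^+ 2 / 8 by rewrite !ge_min lexx !orbT.
have near_ball (c : H) (d : R) : 0 < d ->
    (forall s, a <= s -> s != t -> `|s - t| < d ->
      `|c - (s - t)^-1 *: (f s - f t)| < e) ->
    exists x, nbhs ((fun s => (s - t)^-1 *: (f s - f t)) @ within `[a, +oo[ t^') (ball x e).
  move=> d0 hd; exists c.
  change (\forall s \near within `[a, +oo[ t^', ball c e ((s - t)^-1 *: (f s - f t))).
  rewrite near_withinE near_withinE; apply/nearP_dist; exists d => // s sd st.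
  by rewrite /= in_itv/= andbT => as_; rewrite -ball_normE/=; exact: hd.
have quot s : s != t -> forall k, `|f s - f t| <= k * `|s - t| ->
    `|(s - t)^-1 *: (f s - f t)| <= k.
  move=> st k; have st0 : 0 < `|s - t| by rewrite normr_gt0 subr_eq0.
  by rewrite normrZ normfV ler_pdivrMl// mulrC.
have [d1 d10 h1] := incr eta eta0.
have [meta|meta] := leP m eta.
  apply: (near_ball 0 d1) => // s as_ st sd.
  rewrite sub0r normrN; have := quot s st _ (h1 s as_ sd); lra.
have [n gn] := gm eta eta0.
pose c := `|f t - p n|.
have gn0 : 0 < `|g n| by lra.
(* If [f t = p n], the distance to [p n] has a minimum at the interior point [t], so its derivative
   [g n] would vanish. *)
have c0 : 0 < c.
  rewrite normr_gt0; apply/eqP => ft.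
  have h s : `|f s - p n| - `|f t - p n| - (s - t) *: g n = `|f s - p n| - (s - t) * g n.
    by rewrite ft normr0 subr0.
  have gn20 : 0 < `|g n| / 2 by lra.
  have /nearP_dist[d d0 hd] := hg n _ gn20.
  pose r := Num.min (d / 2) (t - a); have r0 : 0 < r by rewrite lt_min; lra.
  have rd : r <= d / 2 by rewrite ge_min lexx.
  have ra : r <= t - a by rewrite ge_min lexx orbT.
  have := hd (t - r); have := hd (t + r); rewrite !h [t - r]addrC [t + r]addrC !addrK.
  have rd' : r < d by lra.
  have ar : a <= r + t by lra.
  have ar' : a <= - r + t by lra.
  rewrite normrN (gtr0_norm r0) => /(_ rd' ar) k1 /(_ rd' ar'); move: k1.
  have := normr_ge0 (f (r + t) - p n); have := normr_ge0 (f (- r + t) - p n).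
  have : 0 < r * `|g n| by rewrite mulr_gt0.
  case: (ltgtP (g n) 0) => [g0|g0|g0].
  - by rewrite (ltr0_norm g0) !ler_norml; lra.
  - by rewrite (gtr0_norm g0) !ler_norml; lra.
  - by move: gn0; rewrite g0 normr0 ltxx.
have ec0 : 0 < eta * c by rewrite mulr_gt0.
(* Differentiating the squared distance exposes [2 * dot (f s - f t) (f t - p n)]. The remainder
   [|f s - f t|^2 <= 4 |s - t|^2] is absorbed by the radius [eta * c / 4] below. *)
have /nearP_dist[d2 d20 h2] := has_derivM (hg n) (hg n) ec0.
(* Quotients [q] have norm at most [m + eta] while [dot u q] is at least [m - 2 * eta]: they nearly
   attain equality in Cauchy-Schwarz, hence lie near [m *: u]. *)
pose u := (Num.sg (g n) / c) *: (f t - p n).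
have u1 : `|u| = 1.
  rewrite normrZ normrM normfV normr_sg -normr_gt0 gn0 (gtr0_norm c0) -/c mul1r mulVf//.
  by rewrite gt_eqF.
apply: (near_ball (m *: u) (Num.min (Num.min d1 d2) (eta * c / 4))).
  by rewrite !lt_min d10 d20/= divr_gt0.
move=> s as_ st; rewrite !lt_min => /andP[/andP[s1 s2] s3].
have f1 := h1 s as_ s1.
have st0 : 0 < `|s - t| by rewrite normr_gt0 subr_eq0.
set q := (s - t)^-1 *: (f s - f t).
have q1 : `|q| <= m + eta by exact: quot f1.
have q2 : `|dot q (f t - p n) - c * g n| <= eta * c.
  have := h2 s s2 as_; rewrite -!expr2 -/c.
  have -> : `|f s - p n| ^+ 2 = `|f s - f t| ^+ 2 + 2 * dot (f s - f t) (f t - p n) + c ^+ 2.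
    by rewrite -(normsqD hdot) addrA subrK.
  have f2 : `|f s - f t| ^+ 2 <= eta * c * `|s - t|.
    have f1' : `|f s - f t| <= 2 * `|s - t|.
      by apply: le_trans f1 _; rewrite ler_wpM2r//; lra.
    by have := normr_ge0 (f s - f t); nra.
  rewrite -[_ *: (_ + _)]/(_ * (_ + _)).
  have -> : dot q (f t - p n) - c * g n =
      (s - t)^-1 * (dot (f s - f t) (f t - p n) - (s - t) * (c * g n)).
    by rewrite dotZl mulrBr mulKf// subr_eq0.
  rewrite normrM normfV ler_pdivrMl// mulrC.
  have := sqr_ge0 `|f s - f t|.
  by rewrite !ler_norml => f0 /andP[k1 k2]; apply/andP; split; lra.
have q3 : m - 2 * eta <= dot u q.
  rewrite dotC dotZr.
  have cV : 0 < c^-1 by rewrite invr_gt0.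
  have -> : Num.sg (g n) / c * dot q (f t - p n) =
     `|g n| + Num.sg (g n) * (c^-1 * (dot q (f t - p n) - c * g n)).
    by rewrite [`|g n|]normrEsg; field; rewrite gt_eqF.
  have k : `|Num.sg (g n) * (c^-1 * (dot q (f t - p n) - c * g n))| <= eta.
    rewrite normrM normr_sg -normr_gt0 gn0 mul1r normrM (gtr0_norm cV).
    by rewrite ler_pdivrMl// (mulrC c eta).
  by move: k; rewrite ler_norml => /andP[k _]; lra.
rewrite -ltr_sqr ?nnegrE ?(ltW e0)//.
rewrite (normsqB hdot) dotZl normrZ u1 mulr1 (ger0_norm m0).
have me0 : 0 <= m + eta by lra.
have : `|q| ^+ 2 <= (m + eta) ^+ 2 by rewrite ler_sqr ?nnegrE.
have : m * (m - 2 * eta) <= m * dot u q by exact: ler_wpM2l.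
have : m * eta <= eta by rewrite ler_piMl// ltW.
have : eta ^+ 2 <= eta by rewrite expr2 ler_piMl// ltW.
have : 0 < e ^+ 2 by rewrite exprn_gt0.
lra.
Qed.

(** When [q n] is close to [x], the increment of [h n] over [[x, y]] is almost [|f y - f x|], so the
    primitive [M] of the supremum [m] dominates the increments of [f]. Density of the values at
    rationals in the range of [f] thus plays the part of separability of [H]. *)
Lemma lipschitz_ae_has_deriv f a b : a < b ->
  (forall x y, `|f x - f y| <= `|x - y|) ->
  {ae mu, forall t, a < t -> t < b -> exists l, has_deriv a f t l}.
Proof.
move=> ab fL.
(* Indices that encode no rational repeat the value 0, which is harmless for a supremum. *)
pose q n : R := ratr (odflt 0 (@unpickle rat n)).
pose h n x := `|f x - f (q n)|.
have hL n x y : `|h n x - h n y| <= `|x - y|.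
  apply: le_trans (fL x y); rewrite /h.
  by apply: le_trans (ler_dist_dist _ _) _; rewrite -subrBB.
have /choice[g gP] : forall n, exists g : R -> R, [/\ measurable_fun setT g,
    forall x, `|g x| <= 1, forall x y, a <= x -> x <= y -> y <= b ->
      `|h n y - h n x| <= (\int[mu]_(t in `]x, y]) `|g t|)%R &
    {ae mu, forall t, a < t -> t < b -> has_deriv a (h n) t (g t)}].
  by move=> n; exact: lipschitz_density.
pose m x := sups (fun n => `|g n x|) 0.
have g_ub x : has_ubound (range (fun n => `|g n x|)).
  by exists 1 => _ [n _ <-]; case: (gP n).
have gm n x : `|g n x| <= m x.
  apply: ub_le_sup; last by exists n.
  by case: (g_ub x) => u ux; exists u => _ [k _ <-]; apply: ux; exists k.
have m1 x : m x <= 1.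
  by apply: ge_sup; [exists `|g 0%N x|, 0%N|move=> _ [n _ <-]; case: (gP n)].
have m01 x : 0 <= m x <= 1 by rewrite m1 (le_trans _ (gm 0%N x)).
have mabs n : measurable_fun setT (fun x => `|g n x|).
  by apply: measurableT_comp => //; case: (gP n).
have mm : measurable_fun setT m by apply: measurable_fun_sups.
pose M x := (\int[mu]_(t in `]a, x]) m t)%R.
have fM x y : a <= x -> x <= y -> y <= b -> `|f y - f x| <= M y - M x.
  move=> ax xy yb; rewrite Rintegral_ocD//.
  apply/ler_addgt0Pr => e e0.
  have [r xr] : exists r : rat, `|x - ratr r| <= e / 2.
    have [r] := @rat_in_itvoo R (x - e / 2) (x + e / 2) (ltac:(lra)).
    by rewrite in_itv/= => /andP[r1 r2]; exists r; rewrite ler_norml; lra.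
  have qE : q (pickle r) = ratr r by rewrite /q pickleK.
  have [_ g1 hg _] := gP (pickle r).
  have := hg x y ax xy yb.
  have : (\int[mu]_(t in `]x, y]) `|g (pickle r) t| <= \int[mu]_(t in `]x, y]) m t)%R.
    apply: le_Rintegral.
    - exact: measurable_itv.
    - by apply: bounded_integrable_oc => // z; rewrite normr_ge0 g1.
    - exact: bounded_integrable_oc.
    - by move=> z _; exact: gm.
  move=> k1 k2.
  have k3 : h (pickle r) x <= e / 2 by rewrite /h qE; apply: le_trans (fL _ _) xr.
  have k4 : `|f y - f x| <= h (pickle r) y + h (pickle r) x.
    by rewrite /h (subrBB (f (q (pickle r)))); exact: ler_normB.
  move: k1 k2 k3 k4 (ler_norm (h (pickle r) y - h (pickle r) x)).
  move: (\int[mu]_(t in _) _)%R (\int[mu]_(t in _) _)%R (h _ y) (h _ x) `|f y - f x|.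
  by clear; move=> A B C D E; lra.
have hder : {ae mu, forall t n, a < t -> t < b -> has_deriv a (h n) t (g n t)}.
  by apply: ae_foralln => n; case: (gP n).
have Mder := ae_has_deriv_integral (fun y => bounded_integrable_oc mm m01 a y)
  (bounded_locally_integrable mm m01).
apply: filterS2 hder Mder => t th tM at_ tb.
apply: (@has_deriv_of_distances f M (fun n => f (q n)) (g ^~ t) a b t (m t)) => //.
- exact: tM.
- by move=> n; exact: th.
- move=> e e0; have hs : has_sup [set `|g n t| | n in [set k | (0 <= k)%N]].
    by split; [exists `|g 0%N t|, 0%N|exists 1 => _ [n _ <-]; case: (gP n)].
  by have [_ [n _ <-] ?] := sup_adherent e0 hs; exists n.
Qed.

End HilbertRademacher.

(** * Absolutely continuous solutions *)

Section AbsolutelyContinuous.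
Context {R : realType} {t0 : R}.
Notation mu := (@lebesgue_measure R).

(* The variation of f over a small open cover of the exceptional null set is
   small by absolute continuity. *)
Lemma ac_mean_value_le (V : normedModType R) (f : R -> V) (g g' : R -> R) a b :
  t0 <= a -> a <= b -> absolutely_continuous a b f ->
  (forall t, a <= t -> t <= b -> has_deriv t0 g t (g' t) /\ 0 <= g' t) ->
  {ae mu, forall t, a <= t -> t <= b ->
    exists2 l, has_deriv t0 f t l & `|l| <= g' t} ->
  `|f b - f a| <= g b - g a.
Proof.
move=> t0a ab fac hg [N [mN N0 hN]].
apply/ler_addgt0Pr => e e0.
pose e' := e / 2 / (b - a + 1).
have e'0 : 0 < e' by rewrite !divr_gt0//; lra.
suff : `|f b - f a| <= g b - g a + e' * (b - a) + e / 2.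
  have : e' * (b - a) <= e / 2 by rewrite mulrAC ler_pdivrMr ?ler_wpM2l//; lra.
  lra.
have e20 : 0 < e / 2 by lra.
have [d d0 fd] := fac _ e20.
have [U [oU NU muU]] : exists U : set R, [/\ open U, N `<=` U & (mu U < d%:E)%E].
  have [|U [oU NU hU]] := lebesgue_regularity_outer mN _ d0.
    by rewrite [X in (X < _)%E]N0 ltry.
  exists U; split => //; have mU := open_measurable oU.
  have := measureU2 mu mN (measurableD mU mN); rewrite setDUK// => h.
  by apply: le_lt_trans h _; rewrite [X in (X + _)%E]N0 add0e.
have mUI x y : measurable (U `&` `]x, y[%classic).
  by apply: measurableI; [exact: open_measurable|exact: measurable_itv].
(* Besides the inequality, the predicate carries the ordered list of intervals with exceptional
   tags, where only the variation of [f] itself is available; all of them lie in [U], so their total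
   length stays below [d]. *)
pose Q x y := exists s : seq (R * R), [/\
  all (fun p => (x <= p.1) && (p.1 <= p.2) && (p.2 <= y)) s,
  pairwise (fun p q => p.2 <= q.1) s,
  ((\sum_(p <- s) (p.2 - p.1))%:E <= mu (U `&` `]x, y[%classic))%E &
  `|f y - f x| <= g y - g x + e' * (y - x) + \sum_(p <- s) `|f p.2 - f p.1|].
have [s [s_in s_pw s_len s_le]] : Q a b.
  apply: cousin => //.
    move=> x y z ax xy yz zb [s [si sp sl sf]] [s' [si' sp' sl' sf']].
    exists (s ++ s'); split.
    - rewrite all_cat; apply/andP; split.
        by apply: sub_all si => p /andP[/andP[-> ->] /= /le_trans]; apply.
      by apply: sub_all si' => p /andP[/andP[/(le_trans xy) -> ->]].
    - rewrite pairwise_cat sp sp' andbT; apply/andP; split => //.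
      apply/allrelP => p q /(allP si)/andP[_ py] /(allP si')/andP[/andP[yq _] _].
      exact: le_trans py yq.
    - rewrite big_cat/= EFinD; apply: le_trans (leeD sl sl') _.
      have disj : (U `&` `]x, y[%classic) `&` (U `&` `]y, z[%classic) = set0.
        rewrite -subset0 => r [[_ +] [_]]; rewrite /= !in_itv/= => /andP[_ ry] /andP[yr _].
        by move: (lt_trans ry yr); rewrite ltxx.
      rewrite -(measureU mu (mUI x y) (mUI y z) disj).
      apply: (le_measure mu).
      + by apply/mem_set; apply: measurableU; exact: mUI.
      + by apply/mem_set; exact: mUI.
      + move=> r; rewrite /= !in_itv/= => -[] [Ur /andP[r1 r2]]; split => //;
        apply/andP; split; lra.
    - rewrite big_cat/=.
      have := ler_normD (f z - f y) (f y - f x).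
      by rewrite addrA subrK; lra.
  move=> t at_ tb; have [gt gt0] := hg t at_ tb.
  have [[l fl lg]|nP] := pselect (exists2 l, has_deriv t0 f t l & `|l| <= g' t).
    have [r r0 hr] := has_deriv_increment_le fl gt lg e'0.
    exists r => // x y ax xt ty yb xr yr; exists [::]; split => //.
      by rewrite big_nil measure_ge0.
    by rewrite big_nil addr0; apply: hr => //; lra.
  have Ut : U t by apply: NU; apply: hN => h; apply: nP; exact: h.
  have /nearP_dist[r1 r10 hr1] : \forall s \near t, U s by apply: open_nbhs_nbhs; split.
  (* At an exceptional tag the interval [(x, y)] goes into the list. It remains to see that the [g]
     part is nonnegative up to [e'], by comparing [g] with a zero curve. *)
  have g0 : `|0 : V| <= g' t by rewrite normr0.
  have [r2 r20 hr2] := has_deriv_increment_le (has_deriv_cst (0 : V) t) gt g0 e'0.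
  exists (Num.min r1 r2); first by rewrite lt_min r10.
  move=> x y ax xt ty yb; rewrite ltrBlDr -ltrBlDl -(ltrBlDl y) !lt_min.
  move=> /andP[x1 x2] /andP[y1 y2]; exists [:: (x, y)]; split => /=.
  - by rewrite !lexx (le_trans xt ty).
  - by [].
  - rewrite big_seq1/= setIidr; last first.
      by move=> z; rewrite /= in_itv/= => /andP[xz zy]; apply: hr1; rewrite ltr_norml; lra.
    by rewrite lebesgue_measure_itv/= lte_fin; case: ltP => // yx; rewrite lee_fin; lra.
  - rewrite big_seq1/=.
    have := hr2 x y; rewrite subrr normr0 => h.
    have : 0 <= g y - g x + e' * (y - x) by apply: h => //; lra.
    by have := normr_ge0 (f y - f x); lra.
suff : \sum_(p <- s) `|f p.2 - f p.1| < e / 2 by lra.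
pose n := size s; pose p i := nth (0, 0) s i.
have sumE (F : R * R -> R) : \sum_(q <- s) F q = \sum_(i < n) F (p i).
  by rewrite (big_nth (0, 0)) big_mkord.
have p_lt i j : (i < n)%N -> (j < n)%N -> (i < j)%N -> (p i).2 <= (p j).1.
  by move=> ni nj ij; exact: (pairwiseP (0, 0) s_pw).
rewrite sumE; apply: fd => [i||].
- have := allP s_in (p i) (mem_nth _ (ltn_ord i)).
  by move=> /andP[/andP[-> ->] ->].
- move=> i j _ _ [z] []; rewrite /= !in_itv/= => /andP[iz zi] /andP[jz zj].
  have [ij|ji|ij] := ltngtP i j; last exact: val_inj.
    have pij := p_lt i j (ltn_ord i) (ltn_ord j) ij.
    by move: (lt_trans (le_lt_trans pij jz) zi); rewrite ltxx.
  have pji := p_lt j i (ltn_ord j) (ltn_ord i) ji.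
  by move: (lt_trans (le_lt_trans pji iz) zj); rewrite ltxx.
- rewrite -(sumE (fun p => p.2 - p.1)) -lte_fin; apply: le_lt_trans s_len _.
  apply: le_lt_trans muU; apply: (le_measure mu).
  + by apply/mem_set; exact: mUI.
  + by apply/mem_set; exact: open_measurable.
  + by move=> ? [].
Qed.

End AbsolutelyContinuous.

(** * Locally Lipschitz and locally absolutely continuous curves *)

Section LocallyLipschitz.
Context {R : realType} {t0 : R}.
Notation mu := (@lebesgue_measure R).

Definition loc_lipschitz (V : normedModType R) (f : R -> V) :=
  forall T, t0 <= T -> exists2 L : R, 0 <= L &
    forall s t, t0 <= s -> s <= T -> t0 <= t -> t <= T -> `|f s - f t| <= L * `|s - t|.

Section Vector.
Context {V : normedModType R}.
Implicit Types (f g : R -> V).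

Lemma loc_lipschitz_ac f : loc_lipschitz f -> loc_absolutely_continuous t0 f.
Proof.
move=> fL T /fL[L L0 hL] e e0.
exists (e / (L + 1)); first by rewrite divr_gt0//; lra.
move=> n u v huv _; rewrite ltr_pdivlMr; last lra.
apply: le_lt_trans; rewrite mulr_suml; apply: ler_sum => i _.
have [u0 uv vT] := huv i.
apply: le_trans (hL _ _ _ _ _ _) _; try lra.
by rewrite ger0_norm; nra.
Qed.

Lemma C1_loc_lipschitz f f' : (forall t, t0 <= t -> has_deriv t0 f t (f' t)) ->
  (forall t, t0 <= t -> cont_from t0 f' t) -> loc_lipschitz f.
Proof.
move=> hf hf' T t0T.
have [M hM] := cont_from_bounded (lexx t0) t0T (fun t t0t _ => hf' t t0t).
have main s t : t0 <= s -> s <= t -> t <= T -> `|f t - f s| <= `|M| * (t - s).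
  move=> t0s st tT.
  have := @mean_value_le _ t0 _ f (fun r => (r - s) *: `|M|) f' (fun=> `|M|) s t t0s st.
  rewrite subrr scale0r subr0 [`|M| * _]mulrC; apply => r sr rt; split.
  - by apply: hf; lra.
  - exact: (has_deriv_affine (V := R)).
  - by apply: le_trans (hM _ _ _) (ler_norm _); lra.
exists `|M| => // s t t0s sT t0t tT; have [st|ts] := leP s t.
  by rewrite distrC (distrC s) (@ger0_norm _ (t - s)); [exact: main|lra].
by rewrite (@ger0_norm _ (s - t)); [apply: main => //; exact: ltW|lra].
Qed.

Lemma loc_lipschitz_bounded f T : t0 <= T -> loc_lipschitz f ->
  exists2 M : R, 0 <= M & forall t, t0 <= t -> t <= T -> `|f t| <= M.
Proof.
move=> t0T /(_ T t0T)[L L0 hL]; exists (L * (T - t0) + `|f t0|).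
  by rewrite addr_ge0// mulr_ge0//; lra.
move=> t t0t tT; rewrite -(subrK (f t0) (f t)); apply: le_trans (ler_normD _ _) _.
rewrite lerD2r; apply: le_trans (hL _ _ _ _ _ _) _ => //.
by rewrite ger0_norm; [apply: ler_wpM2l => //; lra|lra].
Qed.

Lemma loc_lipschitzD f g : loc_lipschitz f -> loc_lipschitz g ->
  loc_lipschitz (fun t => f t + g t).
Proof.
move=> fL gL T t0T; have [L L0 hL] := fL T t0T; have [K K0 hK] := gL T t0T.
exists (L + K); first exact: addr_ge0.
move=> s t t0s sT t0t tT; rewrite opprD addrACA mulrDl.
by apply: le_trans (ler_normD _ _) _; apply: lerD; [exact: hL|exact: hK].
Qed.

Lemma loc_lipschitzN f : loc_lipschitz f -> loc_lipschitz (fun t => - f t).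
Proof.
move=> fL T t0T; have [L L0 hL] := fL T t0T; exists L => // s t *.
by rewrite -opprD normrN; exact: hL.
Qed.

Lemma loc_lipschitzB f g : loc_lipschitz f -> loc_lipschitz g ->
  loc_lipschitz (fun t => f t - g t).
Proof. by move=> fL gL; apply: loc_lipschitzD => //; exact: loc_lipschitzN. Qed.

Lemma loc_lipschitz_cst (x : V) : loc_lipschitz (fun=> x).
Proof. by move=> T t0T; exists 0 => // s t *; rewrite subrr normr0 mul0r. Qed.

Lemma eq_loc_lipschitz f g : (forall t, t0 <= t -> f t = g t) ->
  loc_lipschitz f -> loc_lipschitz g.
Proof.
move=> fg fL T t0T; have [L L0 hL] := fL T t0T; exists L => // s t *.
by rewrite -!fg//; exact: hL.
Qed.

Lemma loc_lipschitz_comp (W : normedModType R) (F : V -> W) (K : R) f : 0 <= K ->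
  (forall x y, `|F x - F y| <= K * `|x - y|) -> loc_lipschitz f ->
  loc_lipschitz (fun t => F (f t)).
Proof.
move=> K0 FK fL T t0T; have [L L0 hL] := fL T t0T.
exists (K * L); first exact: mulr_ge0.
move=> s t t0s sT t0t tT; apply: le_trans (FK _ _) _.
by rewrite -mulrA ler_wpM2l//; exact: hL.
Qed.

Lemma loc_ac_cont f t : t0 <= t -> loc_absolutely_continuous t0 f -> cont_from t0 f t.
Proof.
move=> t0t fac; apply/cont_fromP => e e0.
have [d d0 hd] := fac (t + 1) (ltac:(lra)) e e0.
have main u v : t0 <= u -> u <= v -> v <= t + 1 -> v - u < d -> `|f v - f u| <= e.
  move=> t0u uv vt uvd.
  have := hd 1%N (fun=> u) (fun=> v); rewrite !big_ord1 => h; apply/ltW/h => //.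
  by move=> i j _ _ _; rewrite (ord1 i) (ord1 j).
apply/nearP_dist; exists (Num.min d 1); first by rewrite lt_min d0/=.
move=> s; rewrite lt_min !ltr_norml => /andP[/andP[sd ds] /andP[s1 s2]] t0s.
have [ts|st] := leP t s; first by apply: main => //; lra.
by rewrite distrC; apply: main => //; lra.
Qed.

Lemma loc_acD f g : loc_absolutely_continuous t0 f -> loc_absolutely_continuous t0 g ->
  loc_absolutely_continuous t0 (fun t => f t + g t).
Proof.
move=> fac gac T t0T e e0.
have e20 : 0 < e / 2 by lra.
have [d d0 hd] := fac T t0T _ e20; have [r r0 hr] := gac T t0T _ e20.
exists (Num.min d r); first by rewrite lt_min d0.
move=> n u v huv tI; rewrite lt_min => /andP[sd sr].
apply: (@le_lt_trans _ _ (\sum_(i < n) (`|f (v i) - f (u i)| + `|g (v i) - g (u i)|))).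
  by apply: ler_sum => i _; rewrite opprD addrACA; exact: ler_normD.
by rewrite big_split/=; have := hd n u v huv tI sd; have := hr n u v huv tI sr; lra.
Qed.

Lemma loc_acN f : loc_absolutely_continuous t0 f ->
  loc_absolutely_continuous t0 (fun t => - f t).
Proof.
move=> fac T t0T e e0; have [d d0 hd] := fac T t0T e e0; exists d => // n u v h1 h2 h3.
under eq_bigr do rewrite -opprD normrN.
exact: hd.
Qed.

End Vector.

Lemma loc_lipschitzZ (V : normedModType R) (k : R -> R) (f : R -> V) :
  loc_lipschitz (V := R) k -> loc_lipschitz f ->
  loc_lipschitz (fun t => k t *: f t).
Proof.
move=> kL fL T t0T; have [L L0 hL] := kL T t0T; have [K K0 hK] := fL T t0T.
have [M M0 hM] := loc_lipschitz_bounded t0T kL.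
have [N N0 hN] := loc_lipschitz_bounded t0T fL.
exists (M * K + L * N); first by rewrite addr_ge0// mulr_ge0.
move=> s t t0s sT t0t tT.
have -> : k s *: f s - k t *: f t = k s *: (f s - f t) + (k s - k t) *: f t.
  by rewrite scalerBr scalerBl addrA subrK.
apply: le_trans (ler_normD _ _) _; rewrite !normrZ mulrDl; apply: lerD.
  by rewrite -mulrA; apply: ler_pM => //; [exact: hM|exact: hK].
by rewrite mulrAC; apply: ler_pM => //; [exact: hL|exact: hN].
Qed.

(** On each []t0, t0 + n + 1[] the curve is precomposed with the projection [c] onto the closed
    interval and rescaled to Lipschitz constant 1 on all of [R]. Countably many null sets and the
    point [t0] are discarded. *)
Lemma loc_lipschitz_ae_has_deriv (H : completeNormedModType R)
    (dot : {dot H for (idfun : R -> R)}) (f : R -> H) : induces_norm dot ->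
  loc_lipschitz f -> {ae mu, forall t, t0 <= t -> exists l, has_deriv t0 f t l}.
Proof.
move=> hdot fL.
have ae_n n : {ae mu, forall t, t0 < t -> t < t0 + n.+1%:R -> exists l, has_deriv t0 f t l}.
  set T := t0 + n.+1%:R; have t0T : t0 < T by rewrite ltrDl.
  have [L L0 hL] := fL T (ltW t0T).
  pose c t := Num.max t0 (Num.min T t).
  have cE t : t0 <= t -> t <= T -> c t = t.
    by move=> h1 h2; rewrite /c min_r// max_r.
  have c_in t : t0 <= c t <= T.
    by rewrite le_max lexx ge_max (ltW t0T) ge_min lexx.
  have cL s t : `|c s - c t| <= `|s - t|.
    have maxL (a x y : R) : `|Num.max a x - Num.max a y| <= `|x - y|.
      case: (ger0P (x - y)) => h; rewrite ler_norml;
      case: (leP a x) => h1; case: (leP a y) => h2; lra.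
    have minL (a x y : R) : `|Num.min a x - Num.min a y| <= `|x - y|.
      case: (ger0P (x - y)) => h; rewrite ler_norml;
      case: (leP a x) => h1; case: (leP a y) => h2; lra.
    exact: le_trans (maxL _ _ _) (minL _ _ _).
  (* [L + 1] instead of [L], which may be zero. *)
  pose k := (L + 1)^-1; have k0 : 0 < k by rewrite invr_gt0; lra.
  pose fc t := k *: f (c t).
  have fcL s t : `|fc s - fc t| <= `|s - t|.
    rewrite -scalerBr normrZ gtr0_norm// ler_pdivrMl; last lra.
    have /andP[s1 s2] := c_in s; have /andP[t1 t2] := c_in t.
    apply: le_trans (hL _ _ s1 s2 t1 t2) _.
    by have := cL s t; have := normr_ge0 (c s - c t); nra.
  apply: filterS (lipschitz_ae_has_deriv hdot t0T fcL).
  move=> t ht t0t tT; have [l hl] := ht t0t tT; exists (k^-1 *: l).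
  have := has_derivZ (has_deriv_cst (k^-1 : R) t) hl.
  rewrite scale0r addr0; apply: has_deriv_near.
    by rewrite /fc scalerA mulVf ?gt_eqF// scale1r cE// ltW.
  apply/nearP_dist; exists (Num.min (t - t0) (T - t)).
    by rewrite lt_min; apply/andP; split; lra.
  move=> s; rewrite lt_min !ltr_norml => /andP[/andP[s1 s2] /andP[s3 s4]].
  by rewrite /fc scalerA mulVf ?gt_eqF// scale1r cE//; lra.
have ae_t0 : {ae mu, forall t, t != t0}.
  exists [set t0]; split; [exact: measurable_set1|exact: lebesgue_measure_set1|].
  by move=> t /negP; rewrite negbK => /eqP.
apply: filterS2 (ae_foralln ae_n) ae_t0.
move=> t ht tt0 t0t; apply: (ht (Num.truncn (t - t0))).
  by rewrite lt_neqAle eq_sym tt0.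
by rewrite -ltrBlDl truncnS_gt.
Qed.

End LocallyLipschitz.
Arguments loc_lipschitz {R} t0 {V}.

Section AEUniqueness.
Context {R : realType} {t0 : R} {E : normedModType R}.
Notation mu := (@lebesgue_measure R).
Variable f : R -> E -> E.
Hypothesis f_lip : forall T, exists2 L : R, 0 <= L &
  forall t, t0 <= t -> t <= T -> forall X Y, `|f t X - f t Y| <= L * `|X - Y|.

(** Gronwall by iteration: a bound on [|X - Y|] weighted by [expR (2 * L * (t - t0))] reproduces
    itself with half the constant, the almost everywhere mean value inequality replacing
    integration. *)
Lemma ae_solution_unique (X Y : R -> E) : X t0 = Y t0 ->
  loc_absolutely_continuous t0 X -> loc_absolutely_continuous t0 Y ->
  {ae mu, forall t, t0 <= t -> has_deriv t0 X t (f t (X t))} ->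
  {ae mu, forall t, t0 <= t -> has_deriv t0 Y t (f t (Y t))} ->
  forall t, t0 <= t -> X t = Y t.
Proof.
move=> XY0 Xac Yac Xd Yd T t0T.
pose D t := X t - Y t.
have Dac : loc_absolutely_continuous t0 D by apply: loc_acD => //; exact: loc_acN.
have [L L0 hL] := f_lip T.
have [M hM] : exists M, forall t, t0 <= t -> t <= T -> `|D t| <= M.
  by apply: cont_from_bounded t0T _ => // t t0t _; exact: loc_ac_cont.
have M0 : 0 <= M by apply: le_trans (hM t0 (lexx _) t0T).
have main n t : t0 <= t -> t <= T ->
    `|D t| <= M * 2^-1 ^+ n * expR (2 * L * (t - t0)).
  elim: n t => [|n IH] t t0t tT.
    rewrite expr0 mulr1; apply: le_trans (hM _ t0t tT) _.
    by rewrite ler_peMr// -[leLHS]expR0 ler_expR !mulr_ge0//; lra.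
  pose g s := M * 2^-1 ^+ n.+1 * expR (2 * L * (s - t0)).
  have Dt0 : D t0 = 0 by rewrite /D XY0 subrr.
  have : `|D t - D t0| <= g t - g t0.
    apply: (@ac_mean_value_le _ t0 _ D g
      (fun s => M * 2^-1 ^+ n.+1 * (2 * L) * expR (2 * L * (s - t0)))) => //.
    - exact: Dac.
    - move=> s t0s st; split; first exact: has_deriv_expR.
      by rewrite !mulr_ge0// ?exprn_ge0// expR_ge0.
    - apply: filterS2 Xd Yd.
      move=> s Xs Ys t0s st; have sT := le_trans st tT.
      exists (f s (X s) - f s (Y s)); first exact: has_derivB (Xs t0s) (Ys t0s).
      apply: le_trans (hL _ t0s sT _ _) _.
      apply: le_trans (ler_wpM2l L0 (IH _ t0s sT)) _.
      by rewrite exprS le_eqVlt; apply/orP; left; apply/eqP; field.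
  rewrite Dt0 subr0 => /le_trans; apply.
  by rewrite gerBl !mulr_ge0// ?expR_ge0// exprn_ge0.
apply/eqP; rewrite -subr_eq0 -normr_le0.
have h : (fun n => M * 2^-1 ^+ n * expR (2 * L * (T - t0))) @ \oo -->
    M * 0 * expR (2 * L * (T - t0)).
  apply: cvgM; last exact: cvg_cst.
  apply: cvgM; first exact: cvg_cst.
  by apply: cvg_expr; rewrite ger0_norm ?invr_ge0// invf_lt1// ltr1n.
rewrite mulr0 mul0r in h.
by apply: (ler_cvg_to (cvg_cst _) h); apply: nearW => n; exact: main.
Qed.

End AEUniqueness.

Section Pairs.
Context {R : realType} {t0 : R}.

Lemma within_continuous_cont_from (V : normedModType R) (f : R -> V) :
  {within `[t0, +oo[, continuous f} <-> forall t, t0 <= t -> cont_from t0 f t.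
Proof.
split=> [/subspace_continuousP h t t0t|h].
  by apply: h; rewrite /= in_itv/= andbT.
by apply/subspace_continuousP => t; rewrite /= in_itv/= andbT; exact: h.
Qed.

Context {U V : normedModType R}.
Implicit Types (f : R -> U) (g : R -> V).

Lemma norm_fst_le (x : U * V) : `|x.1| <= `|x|.
Proof. by rewrite [leRHS]prod_normE le_max lexx. Qed.

Lemma norm_snd_le (x : U * V) : `|x.2| <= `|x|.
Proof. by rewrite [leRHS]prod_normE le_max lexx orbT. Qed.

Lemma norm_pair_le (x : U) (y : V) (M : R) : `|x| <= M -> `|y| <= M -> `|(x, y)| <= M.
Proof. by move=> xM yM; rewrite prod_normE ge_max xM. Qed.

Lemma has_deriv_fst (h : R -> U * V) t l : has_deriv t0 h t l ->
  has_deriv t0 (fun s => (h s).1) t l.1.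
Proof.
move=> hl e /hl; apply: filterS => s hs /hs; apply: le_trans.
exact: (norm_fst_le (h s - h t - (s - t) *: l)).
Qed.

Lemma has_deriv_snd (h : R -> U * V) t l : has_deriv t0 h t l ->
  has_deriv t0 (fun s => (h s).2) t l.2.
Proof.
move=> hl e /hl; apply: filterS => s hs /hs; apply: le_trans.
exact: (norm_snd_le (h s - h t - (s - t) *: l)).
Qed.

Lemma has_deriv_pair f g t l m : has_deriv t0 f t l -> has_deriv t0 g t m ->
  has_deriv t0 (fun s => (f s, g s)) t (l, m).
Proof.
move=> hl hm e e0; apply: filterS2 (hl e e0) (hm e e0) => s h1 h2 t0s.
by apply: norm_pair_le; [exact: h1|exact: h2].
Qed.

Lemma cont_from_pair f g t : cont_from t0 f t -> cont_from t0 g t ->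
  cont_from t0 (fun s => (f s, g s)) t.
Proof.
move=> /cont_fromP hf /cont_fromP hg; apply/cont_fromP => e e0.
apply: filterS2 (hf e e0) (hg e e0) => s h1 h2 t0s.
by apply: norm_pair_le; [exact: h1|exact: h2].
Qed.

Lemma loc_ac_pair f g : loc_absolutely_continuous t0 f -> loc_absolutely_continuous t0 g ->
  loc_absolutely_continuous t0 (fun t => (f t, g t)).
Proof.
move=> fac gac T t0T e e0.
have e20 : 0 < e / 2 by lra.
have [d d0 hd] := fac T t0T _ e20; have [r r0 hr] := gac T t0T _ e20.
exists (Num.min d r); first by rewrite lt_min d0.
move=> n u v huv tI; rewrite lt_min => /andP[sd sr].
apply: (@le_lt_trans _ _ (\sum_(i < n) (`|f (v i) - f (u i)| + `|g (v i) - g (u i)|))).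
  apply: ler_sum => i _.
  by apply: (norm_pair_le (x := f (v i) - f (u i)) (y := g (v i) - g (u i)));
    rewrite ?lerDl ?lerDr.
by rewrite big_split/=; have := hd n u v huv tI sd; have := hr n u v huv tI sr; lra.
Qed.

End Pairs.

(** * The second-order equation *)

Section SecondOrder.
Context {R : realType} {H : completeNormedModType R}.
Context {dot : {dot H for (idfun : R -> R)}} (hdot : induces_norm dot).
Notation mu := (@lebesgue_measure R).
Variables (t0 : R) (a c c' b : R -> R) (T : R -> H -> H).
Hypothesis a_cont : forall t, t0 <= t -> cont_from (V := R) t0 a t.
Hypothesis b_cont : forall t, t0 <= t -> cont_from (V := R) t0 b t.
Hypothesis c_deriv : forall t, t0 <= t -> has_deriv (V := R) t0 c t (c' t).
Hypothesis c'_cont : forall t, t0 <= t -> cont_from (V := R) t0 c' t.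
Hypothesis T_lip : forall Tm, exists2 L : R, 0 <= L &
  forall t, t0 <= t -> t <= Tm -> forall X Y, `|T t X - T t Y| <= L * `|X - Y|.
(** The only regularity in time asked of [T]: constant curves give continuity of the vector field in
    [t], solution curves give differentiability of [T t (x t)] almost everywhere. *)
Hypothesis T_curve : forall x : R -> H, loc_lipschitz t0 x ->
  loc_lipschitz t0 (fun t => T t (x t)).

(* With y = x' + c T(x), the equation becomes the first-order system
   x' = y - c T(x),  y' = - a (y - c T(x)) + (c' - b) T(x). *)
Let F (t : R) (X : H * H) : H * H :=
  let v := X.2 - c t *: T t X.1 in (v, - (a t *: v) + (c' t - b t) *: T t X.1).

Let c_lip : loc_lipschitz (V := R) t0 c.
Proof. exact: C1_loc_lipschitz c_deriv c'_cont. Qed.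

Let loc_lip_cont (V : normedModType R) (f : R -> V) t : t0 <= t ->
  loc_lipschitz t0 f -> cont_from t0 f t.
Proof. by move=> t0t /loc_lipschitz_ac; exact: loc_ac_cont. Qed.

Let F_cont X t : t0 <= t -> cont_from t0 (F ^~ X) t.
Proof.
move=> t0t.
have TX : cont_from t0 (fun s => T s X.1) t.
  by apply: loc_lip_cont => //; apply: T_curve; exact: loc_lipschitz_cst.
have vX : cont_from t0 (fun s => X.2 - c s *: T s X.1) t.
  apply: cvgB; first exact: cvg_cst.
  by apply: cvgZ => //; exact: has_deriv_cont (c_deriv t0t).
apply: cont_from_pair => //; apply: cvgD.
  by apply: cvgN; apply: cvgZ => //; exact: a_cont.
by apply: cvgZ => //; apply: cvgB; [exact: c'_cont|exact: b_cont].
Qed.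

Let F_lip Tm : exists2 L : R, 0 <= L &
  forall t, t0 <= t -> t <= Tm -> forall X Y, `|F t X - F t Y| <= L * `|X - Y|.
Proof.
have [Tt|tT] := ltP Tm t0; first by exists 0 => // t *; exfalso; lra.
have [L L0 hL] := T_lip Tm.
have bounded (k : R -> R) : (forall t, t0 <= t -> cont_from (V := R) t0 k t) ->
    exists2 M : R, 0 <= M & forall t, t0 <= t -> t <= Tm -> `|k t| <= M.
  move=> kc; have [M hM] := cont_from_bounded (lexx t0) tT (fun t h _ => kc t h).
  by exists M => //; apply: le_trans (hM t0 (lexx _) tT).
have [A A0 hA] := bounded a a_cont.
have [C C0 hC] := bounded c (fun t h => has_deriv_cont (c_deriv h)).
have [C' C'0 hC'] := bounded c' c'_cont.
have [B B0 hB] := bounded b b_cont.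
pose K := 1 + C * L; have K0 : 0 <= K by rewrite addr_ge0// mulr_ge0.
have K1 : 0 <= (C' + B) * L by rewrite mulr_ge0// addr_ge0.
exists (K + A * K + (C' + B) * L); first by rewrite !addr_ge0// mulr_ge0.
move=> t t0t tTm X Y.
have dT : `|T t X.1 - T t Y.1| <= L * `|X - Y|.
  apply: le_trans (hL t t0t tTm _ _) _; rewrite ler_wpM2l//.
  exact: (norm_fst_le (X - Y)).
have N0 := normr_ge0 (X - Y).
have dv : `|(X.2 - c t *: T t X.1) - (Y.2 - c t *: T t Y.1)| <= K * `|X - Y|.
  have -> : (X.2 - c t *: T t X.1) - (Y.2 - c t *: T t Y.1) =
      (X.2 - Y.2) - c t *: (T t X.1 - T t Y.1).
    by rewrite scalerBr subrBB_exchange.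
  apply: le_trans (ler_normB _ _) _; rewrite /K mulrDl mul1r; apply: lerD.
    exact: (norm_snd_le (X - Y)).
  by rewrite normrZ -mulrA; apply: ler_pM => //; exact: hC.
have AK : 0 <= A * K by rewrite mulr_ge0.
apply: norm_pair_le => /=.
  by apply: le_trans dv _; rewrite ler_wpM2r//; lra.
rewrite /F /=; set v := X.2 - _; set w := Y.2 - _.
have -> : - (a t *: v) + (c' t - b t) *: T t X.1 - (- (a t *: w) + (c' t - b t) *: T t Y.1) =
   - (a t *: (v - w)) + (c' t - b t) *: (T t X.1 - T t Y.1).
  by rewrite opprD addrACA -opprD (scalerBr (a t) v w) (scalerBr (c' t - b t)).
apply: le_trans (ler_normD _ _) _; rewrite normrN !normrZ.
have k1 : `|a t| * `|v - w| <= A * (K * `|X - Y|).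
  by apply: ler_pM => //; exact: hA.
have k2 : `|c' t - b t| * `|T t X.1 - T t Y.1| <= (C' + B) * (L * `|X - Y|).
  apply: ler_pM => //; apply: le_trans (ler_normB _ _) _.
  by apply: lerD; [exact: hC'|exact: hB].
have k3 : 0 <= K * `|X - Y| by rewrite mulr_ge0.
move: k1 k2 k3; clearbody K; move: (`|a t| * _) (`|c' t - b t| * _) `|X - Y|.
by move=> p q N; lra.
Qed.

Variables (x0 u0 : H).

(** The identity [x' = y - c T(x)] holds at every point of the half-line, so [x'] is locally
    Lipschitz, and it is differentiable wherever [T(x)] is; differentiating it there gives back the
    equation. *)
Lemma second_order_exists : exists x, strong_global_solution t0 a c b T x0 u0 x.
Proof.
have [X [Xt0 hX]] := cauchy_lipschitz F_cont F_lip (x0, u0 + c t0 *: T t0 x0).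
pose x t := (X t).1; pose y t := (X t).2.
pose v t := y t - c t *: T t (x t).
have FX_cont t : t0 <= t -> cont_from t0 (fun s => F s (X s)) t.
  move=> t0t; apply: (cont_from_comp_lip F_cont F_lip t0t).
  exact: has_deriv_cont (hX t t0t).
have X_lip : loc_lipschitz t0 X by exact: C1_loc_lipschitz hX FX_cont.
have x_lip : loc_lipschitz t0 x.
  apply: (loc_lipschitz_comp (F := fst) (K := 1)) X_lip => // p q.
  by rewrite mul1r; exact: (norm_fst_le (p - q)).
have y_lip : loc_lipschitz t0 y.
  apply: (loc_lipschitz_comp (F := snd) (K := 1)) X_lip => // p q.
  by rewrite mul1r; exact: (norm_snd_le (p - q)).
have Tx_lip := T_curve x_lip.
have x_deriv t : t0 <= t -> has_deriv t0 x t (v t).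
  by move=> /hX /has_deriv_fst.
have y_deriv t : t0 <= t ->
    has_deriv t0 y t (- (a t *: v t) + (c' t - b t) *: T t (x t)).
  by move=> /hX /has_deriv_snd.
have v_lip : loc_lipschitz t0 v.
  by apply: loc_lipschitzB => //; exact: loc_lipschitzZ c_lip Tx_lip.
have x'E t : t0 <= t -> derive_from t0 x t = v t.
  by move=> t0t; have [] := has_deriv_from t0t (x_deriv t t0t).
have x'_lip : loc_lipschitz t0 (derive_from t0 x).
  by apply: eq_loc_lipschitz v_lip => t t0t; rewrite x'E.
exists x; split.
- by move=> t t0t; have [] := has_deriv_from t0t (x_deriv t t0t).
- by split; apply/within_continuous_cont_from => t t0t; exact: loc_lip_cont.
- by split; exact: loc_lipschitz_ac.
- apply: filterS (loc_lipschitz_ae_has_deriv hdot Tx_lip) => t ht t0t.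
  have [l hl] := ht t0t.
  have [dTx Tx'E] := has_deriv_from t0t hl.
  have v_deriv := has_derivB (y_deriv t t0t) (has_derivZ (c_deriv t0t) hl).
  have x'_deriv : has_deriv t0 (derive_from t0 x) t _ :=
    eq_has_deriv t0t (fun s t0s => esym (x'E s t0s)) v_deriv.
  have [dx' x''E] := has_deriv_from t0t x'_deriv.
  split => //; rewrite x''E Tx'E x'E// scalerBl.
  move: (a t *: v t) (c' t *: T t (x t)) (b t *: T t (x t)) (c t *: l) => p q r s.
  rewrite opprD !addrA (ACl ((1*6)*(2*5)*(3*8)*(4*7))%AC)/=.
  by rewrite !addNr subrr !addr0.
- by rewrite x'E// /v /x /y Xt0/= addrK.
Qed.

Let reduction (x : R -> H) t := (x t, derive_from t0 x t + c t *: T t (x t)).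

(** Continuity of [x'] makes an arbitrary strong solution locally Lipschitz; [T_curve] then applies
    and [x' + c T(x)] is absolutely continuous, as the uniqueness lemma demands. *)
Let reduction_solution (x : R -> H) : strong_global_solution t0 a c b T x0 u0 x ->
  [/\ reduction x t0 = (x0, u0 + c t0 *: T t0 x0),
    loc_absolutely_continuous t0 (reduction x) &
    {ae mu, forall t, t0 <= t -> has_deriv t0 (reduction x) t (F t (reduction x t))}].
Proof.
move=> [dx [xc x'c] [xac x'ac] xeq [xt0 x't0]].
have x_deriv t : t0 <= t -> has_deriv t0 x t (derive_from t0 x t).
  by move=> /dx; exact: derivable_from_has_deriv.
have x_lip : loc_lipschitz t0 x.
  by apply: C1_loc_lipschitz x_deriv _; exact/within_continuous_cont_from.
have Tx_lip := T_curve x_lip.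
split; first by rewrite /reduction xt0 x't0.
- apply: loc_ac_pair => //; apply: loc_acD => //.
  by apply: loc_lipschitz_ac; exact: loc_lipschitzZ c_lip Tx_lip.
- apply: filterS xeq => t ht t0t; have [dx' dTx eq] := ht t0t.
  apply: has_deriv_pair; rewrite /= addrK; first exact: x_deriv.
  have := has_derivD (derivable_from_has_deriv dx')
    (has_derivZ (c_deriv t0t) (derivable_from_has_deriv dTx)).
  suff -> : derive_from t0 (derive_from t0 x) t +
      (c t *: derive_from t0 (fun t => T t (x t)) t + c' t *: T t (x t)) =
      - (a t *: derive_from t0 x t) + (c' t - b t) *: T t (x t) by [].
  apply/eqP; rewrite -subr_eq0 -[X in _ == X]eq scalerBl; apply/eqP.
  move: (derive_from t0 (derive_from t0 x) t) (a t *: _) (c t *: _) (c' t *: _) (b t *: _).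
  move=> p q r s u.
  rewrite !opprD !opprK !addrA (ACl (1*4*2*6*(3*5))%AC)/=.
  by rewrite subrr addr0.
Qed.

Theorem second_order_exists_unique : exists x,
  strong_global_solution t0 a c b T x0 u0 x /\
  forall y, strong_global_solution t0 a c b T x0 u0 y -> forall t, t0 <= t -> y t = x t.
Proof.
have [x xsol] := second_order_exists; exists x; split=> // y ysol t t0t.
have [x_init x_ac x_ae] := reduction_solution xsol.
have [y_init y_ac y_ae] := reduction_solution ysol.
have := ae_solution_unique F_lip (etrans y_init (esym x_init)) y_ac x_ac y_ae x_ae t0t.
by case.
Qed.

End SecondOrder.

(** * Algebra of continuously differentiable functions on the half-line *)

Section ContinuouslyDifferentiable.
Context {R : realType} {t0 : R}.
Implicit Types f g : R -> R.

(** The derivative is explicit data, so the rules below compute it for sums, products and inverses;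
    [C1_deriv_derive_cont] returns to [derive_from], in terms of which the coefficients are
    defined. *)
Definition C1_deriv f (f' : R -> R) := (forall t, t0 <= t -> has_deriv t0 f t (f' t)) /\
  (forall t, t0 <= t -> cont_from t0 f' t).

Lemma C1_from_deriv f : C1_from t0 f -> C1_deriv f (derive_from t0 f).
Proof.
move=> [df cf]; split; last exact/within_continuous_cont_from.
by move=> t /df; exact: derivable_from_has_deriv.
Qed.

Lemma C1_deriv_cont f f' t : C1_deriv f f' -> t0 <= t -> cont_from t0 f t.
Proof. by move=> [h _] /h; exact: has_deriv_cont. Qed.

Lemma C1_deriv_lipschitz f f' : C1_deriv f f' -> loc_lipschitz t0 f.
Proof. by move=> [h h']; exact: C1_loc_lipschitz h h'. Qed.

Lemma C1_deriv_derive_cont f f' t : C1_deriv f f' -> t0 <= t ->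
  cont_from t0 (derive_from t0 f) t.
Proof.
move=> [h h'] t0t.
have E s : t0 <= s -> derive_from t0 f s = f' s.
  by move=> t0s; have [] := has_deriv_from t0s (h s t0s).
apply/cont_fromP => e /(proj1 (cont_fromP _ _) (h' t t0t)).
by apply: filterS => s hs t0s; rewrite !E//; exact: hs.
Qed.

Lemma C1_derivM f g f' g' : C1_deriv f f' -> C1_deriv g g' ->
  C1_deriv (fun t => f t * g t) (fun t => f t * g' t + f' t * g t).
Proof.
move=> fC gC; split=> t t0t; first exact: has_derivM (fC.1 t t0t) (gC.1 t t0t).
apply: cvgD; apply: cvgM; [exact: C1_deriv_cont fC t0t|exact: gC.2|exact: fC.2|].
exact: C1_deriv_cont gC t0t.
Qed.

Lemma C1_derivD f g f' g' : C1_deriv f f' -> C1_deriv g g' ->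
  C1_deriv (fun t => f t + g t) (fun t => f' t + g' t).
Proof.
move=> fC gC; split=> t t0t; first exact: has_derivD (fC.1 t t0t) (gC.1 t t0t).
by apply: cvgD; [exact: fC.2|exact: gC.2].
Qed.

Lemma C1_derivcB k f f' : C1_deriv f f' -> C1_deriv (fun t => k - f t) (fun t => - f' t).
Proof.
move=> fC; split=> t t0t.
  rewrite -[X in has_deriv _ _ _ X]add0r.
  exact: has_derivB (has_deriv_cst k t) (fC.1 t t0t).
by apply: cvgN; exact: fC.2.
Qed.

Lemma C1_derivV f f' : (forall t, t0 <= t -> f t != 0) -> C1_deriv f f' ->
  C1_deriv (fun t => (f t)^-1) (fun t => - f' t * f t ^- 2).
Proof.
move=> f0 fC; split=> t t0t; first exact: has_derivV (f0 t t0t) (fC.1 t t0t).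
have fc := C1_deriv_cont fC t0t.
apply: cvgM; first by apply: cvgN; exact: fC.2.
by apply: cvgV; [rewrite expf_neq0// f0|rewrite expr2; exact: cvgM].
Qed.

End ContinuouslyDifferentiable.
Arguments C1_deriv {R} t0.

(** * The splitting operator along curves *)

Section SplittingCurves.
Context {R : realType} {H : completeNormedModType R}.
Context {dot : {dot H for (idfun : R -> R)}} (hdot : induces_norm dot).
Context {A : H -> set H} {B : H -> H} {rho nu t0 gmin gmax : R}.
Context {lambda gamma : R -> R}.
Hypotheses (hA : maximal_comonotone dot rho A) (hnu : 0 < nu) (hB : cocoercive dot nu B).
Hypotheses (lambdaC1 : C1_from t0 lambda) (gammaC1 : C1_from t0 gamma).
Hypothesis lambda_gt0 : forall t, t0 <= t -> 0 < lambda t.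
Hypothesis gmin_gt : Num.max 0 (- 2 * rho) < gmin.
Hypothesis gamma_in : forall t, t0 <= t -> gmin <= gamma t <= gmax.

Let gmin0 : 0 < gmin.
Proof. by move: gmin_gt; rewrite gt_max => /andP[]. Qed.

Let gamma_gt0 t : t0 <= t -> 0 < gamma t.
Proof. by move=> /gamma_in /andP[h _]; exact: lt_le_trans h. Qed.

Let gamma_rho t : t0 <= t -> - 2 * rho < gamma t.
Proof.
move=> /gamma_in /andP[h _]; apply: lt_le_trans h.
by move: gmin_gt; rewrite gt_max => /andP[].
Qed.

Let lambdaV : C1_deriv t0 (fun t => (lambda t)^-1) _ :=
  C1_derivV (fun t t0t => lt0r_neq0 (lambda_gt0 t0t)) (C1_from_deriv lambdaC1).

Lemma splitting_lipschitz Tm : exists2 L : R, 0 <= L &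
  forall t, t0 <= t -> t <= Tm -> forall X Y,
    `|splitting A B (lambda t) (gamma t) X - splitting A B (lambda t) (gamma t) Y|
      <= L * `|X - Y|.
Proof.
have [Tt|tT] := ltP Tm t0; first by exists 0 => // t *; exfalso; lra.
have [M M0 hM] := loc_lipschitz_bounded tT (C1_deriv_lipschitz lambdaV).
have nuV : 0 < nu^-1 by rewrite invr_gt0.
have gmax0 : 0 <= gmax.
  by have /andP[h1 h2] := gamma_in (lexx t0); move: gmin0; lra.
(* [M] bounds the inverse of [lambda]; the difference [X - Y] counts once directly and once through
   the nonexpansive resolvent, whose argument adds [gmax * nu^-1] from [gamma t *: B]. *)
exists (M * (2 + gmax * nu^-1)); first by rewrite mulr_ge0// addr_ge0// mulr_ge0// ltW.
move=> t t0t tTm X Y; rewrite /splitting -scalerBr normrZ -mulrA.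
apply: ler_pM => //; first exact: hM.
rewrite subrBB_exchange; apply: le_trans (ler_normB _ _) _.
have := resolvent_dist hdot hA (X - gamma t *: B X) (Y - gamma t *: B Y)
  (gamma_gt0 t0t) (gamma_rho t0t) (gamma_gt0 t0t) (gamma_rho t0t).
rewrite subrr normr0 mul0r addr0 subrBB_exchange -scalerBr => h.
have := ler_normB (X - Y) (gamma t *: (B X - B Y)).
have k : `|gamma t *: (B X - B Y)| <= gmax * (nu^-1 * `|X - Y|).
  rewrite normrZ; apply: ler_pM => //.
    by rewrite gtr0_norm ?gamma_gt0//; have /andP[] := gamma_in t0t.
  exact: (cocoercive_lipschitz hdot X Y hnu hB).
by rewrite mulrDl -mulrA; lra.
Qed.

Lemma splitting_curve_lipschitz (x : R -> H) : loc_lipschitz t0 x ->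
  loc_lipschitz t0 (fun t => splitting A B (lambda t) (gamma t) (x t)).
Proof.
move=> x_lip.
have g_lip := C1_deriv_lipschitz (C1_from_deriv gammaC1).
pose z t := x t - gamma t *: B (x t).
have z_lip : loc_lipschitz t0 z.
  apply: loc_lipschitzB => //; apply: loc_lipschitzZ => //.
  apply: (loc_lipschitz_comp (K := nu^-1)) x_lip; first by rewrite invr_ge0 ltW.
  by move=> u v; exact: (cocoercive_lipschitz hdot u v hnu hB).
pose J t := resolvent (gamma t) A (z t).
have J_dist s t : t0 <= s -> t0 <= t ->
    `|J s - J t| <= `|z s - z t| + `|gamma s - gamma t| * (gmin^-1 * `|z t - J t|).
  move=> t0s t0t.
  have := resolvent_dist hdot hA (z s) (z t)
    (gamma_gt0 t0s) (gamma_rho t0s) (gamma_gt0 t0t) (gamma_rho t0t).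
  move=> /le_trans; apply; rewrite lerD2l ler_wpM2l// ler_wpM2r//.
  by rewrite lef_pV2 ?posrE ?gamma_gt0//; have /andP[] := gamma_in t0t.
have J_lip : loc_lipschitz t0 J.
  move=> T t0T.
  have [Lz Lz0 hz] := z_lip T t0T; have [Lg Lg0 hg] := g_lip T t0T.
  have [Mz Mz0 hMz] := loc_lipschitz_bounded t0T z_lip.
  (* [J_dist] involves [|z t - J t|], not yet known to be bounded. A first use with second point
     [t0] bounds [J] on [[t0, T]] by [MJ]; the second use then has a uniform constant. *)
  pose c := gmin^-1 * `|z t0 - J t0|.
  have c0 : 0 <= c by rewrite mulr_ge0// invr_ge0 ltW.
  pose MJ := (Lz + Lg * c) * (T - t0) + `|J t0|.
  have hMJ t : t0 <= t -> t <= T -> `|J t| <= MJ.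
    move=> t0t tT; rewrite -(subrK (J t0) (J t)).
    apply: le_trans (ler_normD _ _) _; rewrite lerD2r.
    apply: le_trans (J_dist t t0 t0t (lexx _)) _; rewrite -/c.
    have := hz t t0 t0t tT (lexx _) t0T; have := hg t t0 t0t tT (lexx _) t0T.
    rewrite (@ger0_norm _ (t - t0)); last lra.
    move=> k1 k2; have k3 := ler_wpM2r c0 k1.
    have : 0 <= (Lz + Lg * c) * (T - t).
      by apply: mulr_ge0; [rewrite addr_ge0// mulr_ge0|lra].
    by lra.
  pose d := gmin^-1 * (Mz + MJ).
  have d0 : 0 <= d.
    apply: mulr_ge0; first by rewrite invr_ge0 ltW.
    by apply: addr_ge0 => //; apply: le_trans (hMJ t0 (lexx _) t0T).
  exists (Lz + Lg * d); first by rewrite addr_ge0// mulr_ge0.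
  move=> s t t0s sT t0t tT; apply: le_trans (J_dist s t t0s t0t) _.
  rewrite mulrDl; apply: lerD; first exact: hz.
  rewrite mulrAC; apply: ler_pM => //; first by rewrite mulr_ge0// invr_ge0 ltW.
    exact: hg.
  apply: ler_wpM2l; first by rewrite invr_ge0 ltW.
  by apply: le_trans (ler_normB _ _) _; apply: lerD; [exact: hMz|exact: hMJ].
apply: loc_lipschitzZ; first exact: C1_deriv_lipschitz lambdaV.
exact: loc_lipschitzB.
Qed.

End SplittingCurves.

(** The denominators [1 - Gamma] and [delta] do not vanish, so [alpha] and [bcoef], built from C1
    data and their derivatives, are continuous, and [beta] is C1. Together with the two Lipschitz
    properties of the splitting operator, this puts the problem under
    [second_order_exists_unique]. *)
Theorem theorem3p2 (R : realType) (H : completeNormedModType R)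
    (dot : {dot H for (idfun : R -> R)}) (hdot : induces_norm dot)
    (A : H -> set H) (B : H -> H) (rho nu t0 gamma_min gamma_max : R)
    (lambda gamma delta theta phi psi : R -> R)
    (hA : maximal_comonotone dot rho A)
    (hnu : 0 < nu) (hB : cocoercive dot nu B)
    (hlambdaC1 : C1_from t0 lambda) (hgammaC1 : C1_from t0 gamma)
    (hdeltaC1 : C1_from t0 delta) (hthetaC1 : C1_from t0 theta)
    (hphiC1 : C1_from t0 phi) (hpsiC1 : C1_from t0 psi)
    (hlambda : forall t, t0 <= t -> 0 < lambda t)
    (hdelta : forall t, t0 <= t -> 0 < delta t)
    (htheta : forall t, t0 <= t -> 0 <= theta t <= 1)
    (hphi : forall t, t0 <= t -> 0 <= phi t)
    (hpsi : forall t, t0 <= t -> 0 <= psi t)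
    (hgamma_min : Num.max 0 (- 2 * rho) < gamma_min)
    (hgamma_max : gamma_max < 2 * nu)
    (hgamma : forall t, t0 <= t -> gamma_min <= gamma t <= gamma_max)
    (hLambda : 0 < inf (Lambda lambda gamma rho nu @` `[t0, +oo[))
    (hzer : zer (op_add A B) !=set0)
    (hGamma : forall t, t0 <= t -> Gamma theta phi psi t < 1)
    (halpha : forall t, t0 <= t -> 0 < alpha t0 delta theta phi psi t)
    (hb : forall t, t0 <= t -> 0 <= bcoef t0 lambda delta theta phi psi t)
    (hbeta : forall t, t0 <= t -> 0 < beta lambda theta phi psi t)
    (halpha_int : loc_integrable_from t0 (alpha t0 delta theta phi psi))
    (hb_int : loc_integrable_from t0 (bcoef t0 lambda delta theta phi psi))
    (hbeta_ac :
       loc_absolutely_continuous t0 (beta lambda theta phi psi))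
    (x0 u0 : H) :
  let is_solution :=
    strong_global_solution t0
      (alpha t0 delta theta phi psi)
      (beta lambda theta phi psi)
      (bcoef t0 lambda delta theta phi psi)
      (fun t => splitting A B (lambda t) (gamma t)) x0 u0 in
  exists x : R -> H, is_solution x /\
    forall y : R -> H, is_solution y -> forall t, t0 <= t -> y t = x t.
Proof.
have thetaC := C1_from_deriv hthetaC1; have lambdaC := C1_from_deriv hlambdaC1.
have deltaC := C1_from_deriv hdeltaC1.
have GammaC := C1_derivD (C1_derivM thetaC (C1_from_deriv hphiC1))
  (C1_derivM (C1_derivcB 1 thetaC) (C1_from_deriv hpsiC1)).
have Gamma0 t : t0 <= t -> 1 - Gamma theta phi psi t != 0.
  by move=> /hGamma h; rewrite subr_eq0 gt_eqF.
have delta0 t : t0 <= t -> delta t != 0 by move=> /hdelta; exact: lt0r_neq0.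
have GVC := C1_derivV Gamma0 (C1_derivcB 1 GammaC).
have ltC := C1_derivM lambdaC thetaC.
have betaC := C1_derivM ltC GVC.
have delta_log t : t0 <= t -> cont_from t0 (fun s => derive_from t0 delta s / delta s) t.
  move=> t0t; apply: cvgM; first exact: deltaC.2.
  by apply: cvgV; [exact: delta0|exact: C1_deriv_cont deltaC t0t].
apply: (second_order_exists_unique hdot (c' := _) _ _ betaC.1 betaC.2).
- move=> t t0t; apply: cvgB; last exact: delta_log.
  apply: cvgM; last exact: C1_deriv_cont GVC t0t.
  by apply: cvgB; [exact: C1_deriv_cont deltaC t0t|exact: C1_deriv_derive_cont GammaC t0t].
- move=> t t0t; apply: cvgM; last exact: C1_deriv_cont GVC t0t.
  apply: cvgB; first exact: C1_deriv_derive_cont ltC t0t.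
  by apply: cvgM; [exact: C1_deriv_cont ltC t0t|exact: delta_log].
- exact: (splitting_lipschitz hdot hA hnu hB hlambdaC1 hlambda hgamma_min hgamma).
- exact: (splitting_curve_lipschitz hdot hA hnu hB hlambdaC1 hgammaC1 hlambda
    hgamma_min hgamma).
Qed.
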